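(* Let $T>0$, let $\bar\lambda:=\inf\{\lambda : \lambda\in\sigma(A)\}$, and let $\gamma$ be a positive parameter with $\gamma<2\exp(\bar\lambda^2T)$. Given $f\in H$, let $u\in V_p$ be the uniquely determined solution of the problem $$(\partial_t+A^2)u=0\ \text{ in }(0,T)\times\Omega,\qquad u(T)=f .$$ Let $\varphi_0\in H$ be arbitrary and define $\varphi_k:=T_p(\varphi_{k-1})$ for $k\ge1$, where $T_p:H\to H$ is the affine operator $$T_p(\varphi):=(I-\gamma\exp(-A^2T))\varphi+\gamma f .$$ Then the sequence $\varphi_k$ converges to $u(0)$ in the norm of $H$.
   Context: Let $\Omega\subset\mathbb{R}^n$ be an open, bounded set with smooth boundary and let $A$ be a positive ($\langle A\varphi,\varphi\rangle>0$ for $0\neq\varphi$ in the domain of $A$), self-adjoint, unbounded operator with discrete spectrum, densely defined on the Hilbert space $H:=L^2(\Omega)$; $\sigma(A)$ denotes its spectrum. Let $E_\lambda$, $\lambda\in\mathbb{R}$, denote the resolution of the identity associated to $A$. For $s\ge 0$ set $\mathcal{H}^s(\Omega):=\{\varphi\in H : \|\varphi\|_s:=(\int_0^\infty(1+\lambda^2)^s\,d\langle E_\lambda\varphi,\varphi\rangle)^{1/2}<\infty\}$. For $s>0$, $\mathcal{H}^{-s}(\Omega)$ is the dual of $\mathcal{H}^s(\Omega)$ (with pivot space $H$); equivalently, it is the completion of $H$ in the norm $\|\varphi\|_{-s}:=(\int_0^\infty(1+\lambda^2)^{-s}\,d\langle E_\lambda\varphi,\varphi\rangle)^{1/2}$.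 Functions of $A$ are defined by the spectral calculus of $A$. $V_p:=\{u\in L^2(0,T;\mathcal{H}^1(\Omega)) : (\partial_t+A^2)u=0\text{ in }(0,T)\times\Omega\}$, with norm $\|u\|_{V_p}:=(\int_0^T(\|u(t)\|_1^2+\|\partial_tu(t)\|_{-1}^2)\,dt)^{1/2}$. For $u\in V_p$ one has $u(0),u(T)\in H$. The iteration arises as follows: $v_0$ solves $(\partial_t+A^2)v_0=0$ in $(0,T)\times\Omega$, $v_0(0)=\varphi_0$; for $k\ge1$, $v_k$ solves $(\partial_t+A^2)v_k=0$ in $(0,T)\times\Omega$, $v_k(0)=v_{k-1}(0)-\gamma(v_{k-1}(T)-f)$; and $\varphi_k=v_k(0)$. *)

(* Defs.v *)
From HB Require Import structures.
From mathcomp Require Import all_boot all_order all_algebra.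
From mathcomp Require Import all_classical all_reals all_analysis.
From mathcomp Require Import measurable_realfun ring.

Set Implicit Arguments.
Unset Strict Implicit.
Unset Printing Implicit Defensive.

Import Order.TTheory GRing.Theory Num.Theory.
Import numFieldNormedType.Exports.

Local Open Scope classical_set_scope.
Local Open Scope ring_scope.

(* Real inner product spaces whose norm is the one induced by the inner product. *)
HB.mixin Record NormedModule_isPreHilbert (R : realType) H
    & NormedModule R H := {
  dot : H -> H -> R ;
  dotC : forall u v, dot u v = dot v u ;
  dotDl : forall u v w, dot (u + v) w = dot u w + dot v w ;
  dotZl : forall a u v, dot (a *: u) v = a * dot u v ;
  dotuu : forall u, dot u u = `|u| ^+ 2
}.

#[short(type="preHilbertType")]
HB.structure Definition PreHilbert (R : realType) :=
  {H of NormedModule_isPreHilbert R H & NormedModule R H}.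

HB.factory Record Lmodule_isPreHilbert (R : realType) H & GRing.Lmodule R H := {
  inner : H -> H -> R ;
  innerC : forall u v, inner u v = inner v u ;
  innerDl : forall u v w, inner (u + v) w = inner u w + inner v w ;
  innerZl : forall a u v, inner (a *: u) v = a * inner u v ;
  inner_ge0 : forall u, 0 <= inner u u ;
  inner_eq0 : forall u, inner u u = 0 -> u = 0
}.

HB.builders Context R H & Lmodule_isPreHilbert R H.

Let norm u : R := Num.sqrt (inner u u).

Let norm2 u : norm u ^+ 2 = inner u u.
Proof. by rewrite sqr_sqrtr ?inner_ge0. Qed.

Let innerDr u v w : inner u (v + w) = inner u v + inner u w.
Proof. by rewrite innerC innerDl !(innerC _ u). Qed.

Let innerZr a u v : inner u (a *: v) = a * inner u v.
Proof. by rewrite innerC innerZl innerC. Qed.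

Let CauchySchwarz u v : inner u v <= norm u * norm v.
Proof.
have [v0|v0] := eqVneq (inner v v) 0.
  move/inner_eq0 : v0 => ->; rewrite -[X in inner u X](scale0r 0) innerZr mul0r.
  by rewrite mulr_ge0 ?sqrtr_ge0.
have v_gt0 : 0 < inner v v by rewrite lt_neqAle eq_sym v0 inner_ge0.
rewrite -sqrtrM ?inner_ge0// (le_trans (ler_norm _))// -sqrtr_sqr.
apply: ler_wsqrtr; have := inner_ge0 (u - (inner u v / inner v v) *: v).
rewrite -scaleNr innerDl !innerDr !innerZl !innerZr (innerC v u).
have -> : inner u u + - (inner u v / inner v v) * inner u v +
    (- (inner u v / inner v v) * inner u v +
     - (inner u v / inner v v) * (- (inner u v / inner v v) * inner v v)) =
    inner u u - inner u v ^+ 2 / inner v v by field.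
by rewrite subr_ge0 ler_pdivrMr.
Qed.

Let ler_normD u v : norm (u + v) <= norm u + norm v.
Proof.
rewrite -[leRHS]ger0_norm ?addr_ge0 ?sqrtr_ge0// -[leRHS]sqrtr_sqr.
apply: ler_wsqrtr.
rewrite sqrrD !norm2 innerDl !innerDr (innerC v u).
have := CauchySchwarz u v; move: (inner u v) => x xle.
rewrite -!addrA lerD2l !addrA lerD2r -mulr2n.
by rewrite lerMn2r.
Qed.

Let normrZ a u : norm (a *: u) = `|a| * norm u.
Proof.
by rewrite /norm innerZl innerZr mulrA -expr2 sqrtrM ?sqr_ge0// sqrtr_sqr.
Qed.

Let normr0_eq0 u : norm u = 0 -> u = 0.
Proof. by move=> u0; apply: inner_eq0; rewrite -norm2 u0 expr0n. Qed.

HB.instance Definition _ := @Lmodule_isNormed.Build R H norm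
  ler_normD normrZ normr0_eq0.

Let innerE u : inner u u = `|u| ^+ 2.
Proof. by rewrite -norm2. Qed.

HB.instance Definition _ := @NormedModule_isPreHilbert.Build R H inner
  innerC innerDl innerZl innerE.

HB.end.

(* The algebraic and inner product structure of the library's quotient space
   [LspaceType2 mu] of square integrable real-valued functions modulo equality
   almost everywhere. *)
Section L2_space.
Context d (T : measurableType d) (R : realType).
Variable mu : {measure set T -> \bar R}.

Notation L2 := (LspaceType2 mu).
Notation Lfun2 := (@Lfun _ T R mu 2%:E).

Definition L2_fun (f : L2) : T -> R := f.

Lemma L2_funP (f : L2) : L2_fun f \in Lfun2.
Proof.
apply/andP; split; rewrite inE /=.
  exact: (@measurable_funPT _ _ _ _ (repr (LebesgueSpace.sort f))).
exact: (@Lebesgue_finite _ _ _ _ _ _ f).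
Qed.

Lemma L2_eqP (f g : L2) : L2_fun f = L2_fun g %[ae mu] -> f = g.
Proof.
move=> fg.
have efg : LebesgueSpace.sort f = LebesgueSpace.sort g.
  rewrite -[LHS]reprK -[RHS]reprK; apply/eqmodP/asboolP; exact: fg.
case: f g efg {fg} => [f [[pf]]] [g [[pg]]] /= efg.
by subst g; rewrite (Prop_irrelevance pf pg).
Qed.

Section L2_of.
Variables (f : T -> R) (Lf : f \in Lfun2).
Let mf : measurable_fun setT (f : T -> measurableTypeR R).
Proof. by move: Lf => /andP[/[!inE]]. Qed.
Let mff : {mfun T >-> measurableTypeR R} :=
  HB.pack_for {mfun T >-> measurableTypeR R} f (@isMeasurableFun.Build _ _ T (measurableTypeR R) f mf).
Let cl : {mfun_ mu, T >-> measurableTypeR R} := (\pi mff)%qT.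

Let cl_ae : (cl : T -> R) = f %[ae mu].
Proof.
have : (repr cl == mff %[mod {mfun_ mu, T >-> measurableTypeR R}])%qT by rewrite reprK.
by rewrite eqmodE => /asboolP.
Qed.

Let msqr (g : T -> R) : measurable_fun setT g ->
  measurable_fun setT (fun x => (`|(EFin \o g) x| `^ 2)%E).
Proof.
move=> mg; apply/measurable_EFinP.
apply: (@measurableT_comp _ _ _ _ _ _ (@powR R ^~ 2)) => //.
exact: measurableT_comp.
Qed.

Let mcl : measurable_fun setT (cl : T -> R).
Proof. exact: (@measurable_funPT _ _ _ _ (repr cl)). Qed.

Let cl_fin : finite_norm mu 2%:E (cl : T -> R).
Proof.
have := Lf; rewrite inE => /andP[_]; rewrite inE /= /finite_norm.
congr (_ < _)%E; rewrite unlock; congr (_ `^ _)%E.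
apply: ae_eq_integral => //; [exact: msqr|exact: msqr|].
by move: cl_ae; apply: filterS => x /(_ Logic.I) /= ->.
Qed.

Definition L2_of : L2 :=
  HB.pack_for L2 cl (isFinLebesgue.Build _ _ _ mu 2%:E (lee1n 2) cl cl_fin).

Lemma L2_ofE : L2_fun L2_of = f %[ae mu].
Proof. exact: cl_ae. Qed.
End L2_of.


Lemma L2_integrable_mul (f g : L2) :
  mu.-integrable setT (EFin \o (L2_fun f \* L2_fun g)).
Proof. by apply/Lfun1_integrable/Lfun2_mul_Lfun1; exact: L2_funP. Qed.

Let L2D_subproof (f g : L2) : L2_fun f \+ L2_fun g \in Lfun2.
Proof. exact: (Lfun_addr_closed mu (lee1n 2)).2 (L2_funP f) (L2_funP g). Qed.

Let L2Z_subproof a (f : L2) : a \*: L2_fun f \in Lfun2.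
Proof.
have [L0 LD] := Lfun_submod_closed mu (lee1n 2).
by have := LD a _ _ (L2_funP f) L0; rewrite addr0.
Qed.

Definition L2_zero : L2 := L2_of (Lfun_submod_closed mu (lee1n 2)).1.
Definition L2_add f g : L2 := L2_of (L2D_subproof f g).
Definition L2_scale a f : L2 := L2_of (L2Z_subproof a f).

Lemma L2_zeroE : L2_fun L2_zero = cst 0 %[ae mu].
Proof. exact: L2_ofE. Qed.
Lemma L2_addE f g : L2_fun (L2_add f g) = L2_fun f \+ L2_fun g %[ae mu].
Proof. exact: L2_ofE. Qed.
Lemma L2_scaleE a f : L2_fun (L2_scale a f) = a \*: L2_fun f %[ae mu].
Proof. exact: L2_ofE. Qed.

Let L2_addA : associative L2_add.
Proof.
move=> f g h; apply: L2_eqP; near=> x => _.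
rewrite (near (L2_addE f _))//= (near (L2_addE g h))//=.
by rewrite (near (L2_addE _ h))//= (near (L2_addE f g))//= addrA.
Unshelve. all: by end_near. Qed.

Let L2_addC : commutative L2_add.
Proof.
move=> f g; apply: L2_eqP; near=> x => _.
by rewrite (near (L2_addE f _))//= (near (L2_addE g f))//= addrC.
Unshelve. all: by end_near. Qed.

Let L2_add0 : left_id L2_zero L2_add.
Proof.
move=> f; apply: L2_eqP; near=> x => _.
by rewrite (near (L2_addE _ f))//= (near L2_zeroE)//= add0r.
Unshelve. all: by end_near. Qed.

Let L2_addN : left_inverse L2_zero (L2_scale (-1)) L2_add.
Proof.
move=> f; apply: L2_eqP; near=> x => _.
rewrite (near (L2_addE _ f))//= (near L2_zeroE)//= (near (L2_scaleE _ f))//=.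
by rewrite scaleN1r addNr.
Unshelve. all: by end_near. Qed.

HB.instance Definition _ := gen_eqMixin L2.
HB.instance Definition _ := gen_choiceMixin L2.
HB.instance Definition _ :=
  GRing.isZmodule.Build L2 L2_addA L2_addC L2_add0 L2_addN.

Let L2_scaleA a b f : L2_scale a (L2_scale b f) = L2_scale (a * b) f.
Proof.
apply: L2_eqP; near=> x => _.
rewrite (near (L2_scaleE a _))//= (near (L2_scaleE b f))//=.
by rewrite (near (L2_scaleE (a * b) f))//= scalerA.
Unshelve. all: by end_near. Qed.

Let L2_scale1 : left_id 1 L2_scale.
Proof.
move=> f; apply: L2_eqP; near=> x => _.
by rewrite (near (L2_scaleE 1 f))//= scale1r.
Unshelve. all: by end_near. Qed.

Let L2_scaleDr : right_distributive L2_scale +%R.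
Proof.
move=> a f g; apply: L2_eqP; near=> x => _.
rewrite (near (L2_scaleE a (f + g)))//= (near (L2_addE f g))//=.
rewrite (near (L2_addE (L2_scale a f) (L2_scale a g)))//=.
by rewrite (near (L2_scaleE a f))//= (near (L2_scaleE a g))//= scalerDr.
Unshelve. all: by end_near. Qed.

Let L2_scaleDl f : {morph L2_scale^~ f : a b / a + b}.
Proof.
move=> a b; apply: L2_eqP; near=> x => _.
rewrite (near (L2_scaleE (a + b) f))//=.
rewrite (near (L2_addE (L2_scale a f) (L2_scale b f)))//=.
by rewrite (near (L2_scaleE a f))//= (near (L2_scaleE b f))//= scalerDl.
Unshelve. all: by end_near. Qed.

HB.instance Definition _ := GRing.Zmodule_isLmodule.Build R L2
  L2_scaleA L2_scale1 L2_scaleDr L2_scaleDl.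

Definition L2_dot (f g : L2) : R := \int[mu]_x (L2_fun f x * L2_fun g x).

Let L2_dot_ae (f g : L2) (h : T -> R) : h \in Lfun2 ->
  L2_fun f = h %[ae mu] -> L2_dot f g = \int[mu]_x (h x * L2_fun g x).
Proof.
move=> Lh fh; congr fine; apply: ae_eq_integral => //.
- exact: measurable_int (L2_integrable_mul f g).
- have /Lfun1_integrable := Lfun2_mul_Lfun1 Lh (L2_funP g).
  exact: measurable_int.
- by move: fh; apply: filterS => x /(_ Logic.I) /= ->.
Qed.

Let L2_dotC f g : L2_dot f g = L2_dot g f.
Proof. by apply: eq_Rintegral => x _; rewrite mulrC. Qed.

Let L2_dotDl f g h : L2_dot (f + g) h = L2_dot f h + L2_dot g h.
Proof.
rewrite (L2_dot_ae _ (L2D_subproof f g) (L2_addE f g)).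
rewrite -RintegralD//; [|exact: L2_integrable_mul..].
by apply: eq_Rintegral => x _; rewrite /= mulrDl.
Qed.

Let L2_dotZl a f g : L2_dot (a *: f) g = a * L2_dot f g.
Proof.
rewrite (L2_dot_ae _ (L2Z_subproof a f) (L2_scaleE a f)).
rewrite -RintegralZl//; last exact: L2_integrable_mul.
by apply: eq_Rintegral => x _; rewrite /= mulrA.
Qed.

Let L2_dot_ge0 f : 0 <= L2_dot f f.
Proof. by apply: Rintegral_ge0 => x _; rewrite -expr2 sqr_ge0. Qed.

Let L2_dot_eq0 f : L2_dot f f = 0 -> f = 0.
Proof.
move=> f0; have mf := measurable_int _ (L2_integrable_mul f f).
have : (\int[mu]_x `|(EFin \o (L2_fun f \* L2_fun f)%R) x| = 0)%E.
  under eq_integral do rewrite /= ger0_norm -?expr2 ?sqr_ge0//.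
  rewrite -[LHS]fineK; first exact: (congr1 EFin f0).
  exact: integrable_fin_num (L2_integrable_mul f f).
move/(ae_eq_integral_abs mu measurableT mf) => ff0.
apply: L2_eqP; near=> x => _; rewrite (near L2_zeroE)//=.
have : (EFin \o (L2_fun f \* L2_fun f)%R) x = 0%E by rewrite (near ff0).
by case=> /eqP; rewrite -expr2 sqrf_eq0 => /eqP.
Unshelve. all: by end_near. Qed.

HB.instance Definition _ := @Lmodule_isPreHilbert.Build R L2 L2_dot
  L2_dotC L2_dotDl L2_dotZl L2_dot_ge0 L2_dot_eq0.

End L2_space.

(* R^n with its Borel sigma-algebra. *)
Definition Rn (R : realType) (n : nat) := g_sigma_algebraType (@open 'rV[R]_n).

Section euclidean_space.
Variable R : realType.

Definition cons_pair n (x : n.-tuple (measurableTypeR R) * measurableTypeR R) :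
  n.+1.-tuple (measurableTypeR R) := [the n.+1.-tuple _ of x.2 :: x.1].

Lemma measurable_cons_pair n : measurable_fun setT (@cons_pair n).
Proof. exact: measurable_cons. Qed.

(* The n-fold product of the Lebesgue measure on R. *)
Fixpoint lebesgue_tuple n :
    {measure set (n.-tuple (measurableTypeR R)) -> \bar R} :=
  if n is m.+1 then
    [the {measure set _ -> \bar R} of
      @measure_function_pushforward__canonical__measure_function_Measure _ _ _ _ R
        (lebesgue_tuple m \x (@lebesgue_measure R))%E _ (@measurable_cons_pair m)]
  else [the {measure set _ -> \bar R} of dirac [tuple]].

Definition row_of_tuple n (t : n.-tuple (measurableTypeR R)) : Rn R n :=
  \row_i (tnth t i : R).

Lemma measurable_row_of_tuple n : measurable_fun setT (@row_of_tuple n).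
Proof.
refine (@measurability _ _ _ (Rn R n : measurableType _) setT (@row_of_tuple n) (@open 'rV[R]_n) erefl _).
move=> _ [U oU <-]; rewrite setTI.
pose box (c : 'rV[rat]_n * nat) : set 'rV[R]_n :=
  [set x | forall i, `|ratr (c.1 ord0 i) - x ord0 i| < c.2.+1%:R^-1].
pose F (k : nat) : set (n.-tuple (measurableTypeR R)) :=
  if unpickle k is Some c then
    if `[< box c `<=` U >] then @row_of_tuple n @^-1` (box c) else set0
  else set0.
rewrite (_ : _ @^-1` _ = \bigcup_k F k); last first.
  apply/seteqP; split => [t /= Ut|t [k _]]; last first.
    by rewrite /F; case: unpickle => // c; case: asboolP => // + /= => /[apply].
  have : nbhs (row_of_tuple t : 'rV[R]_n) U by exact: open_nbhs_nbhs.
  move=> /nbhs_ballP[e /= e0 eU].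
  have [k ke] : exists k, k.+1%:R^-1 < e / 2.
    exists (Num.bound (e / 2)^-1).
    rewrite invf_plt ?posrE ?divr_gt0//.
    rewrite (lt_trans (archi_boundP _))// ?invr_ge0 ?divr_ge0 ?ltW//.
    by rewrite ltr_nat.
  have exq i : exists q : rat, `|ratr q - tnth t i| < k.+1%:R^-1.
    have := @rat_in_itvoo R (tnth t i - k.+1%:R^-1) (tnth t i + k.+1%:R^-1).
    case.
      by rewrite ltrBlDr -addrA ltrDl addr_gt0// invr_gt0.
    by move=> q; rewrite in_itv/= -ltr_distl => ?; exists q.
  pose c : 'rV[rat]_n := \row_i sval (cid (exq i)).
  have ct : box (c, k) (row_of_tuple t).
    by move=> i; rewrite !mxE /=; exact: (svalP (cid (exq i))).
  exists (pickle (c, k)) => //; rewrite /F pickleK.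
  case: asboolP => // abs; exfalso; apply: abs => x bx; apply: eU; split=> // i j.
  rewrite !ord1 /ball /=.
  have := ct j; have := bx j; rewrite /= => h1 h2.
  rewrite -(subrK (ratr (c ord0 j)) (row_of_tuple t ord0 j)) -addrA.
  rewrite (le_lt_trans (ler_normD _ _))// distrC (splitr e) ltrD//.
    exact: lt_trans ke.
  exact: lt_trans ke.
apply: bigcupT_measurable => k; rewrite /F; case: unpickle => // c.
case: asboolP => // _.
rewrite (_ : _ @^-1` _ = \big[setI/setT]_(i < n)
   ((fun t : n.-tuple (measurableTypeR R) => tnth t i) @^-1`
     (ball (ratr (c.1 ord0 i) : R) c.2.+1%:R^-1))); last first.
  apply/seteqP; split=> t /=.
    move=> h; rewrite -bigcap_seq => i _ /=; have := h i.
    by rewrite mxE.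
  by rewrite -bigcap_seq => h i; rewrite mxE; apply: h; rewrite /= mem_index_enum.
apply: bigsetI_measurable => i _.
rewrite -[X in measurable X]setTI; apply: measurable_tnth => //.
exact: measurable_ball.
Qed.

Definition lebesgue_Rn n : {measure set (Rn R n) -> \bar R} :=
  [the {measure set _ -> \bar R} of
    @measure_function_pushforward__canonical__measure_function_Measure _ _ _ _ R
      (lebesgue_tuple n) _ (@measurable_row_of_tuple n)].

Lemma open_measurable_Rn n (U : set 'rV[R]_n) : open U ->
  measurable (U : set (Rn R n)).
Proof. exact: sub_sigma_algebra. Qed.

End euclidean_space.

Section smooth_boundary.
Variables (R : realType) (n : nat).
Implicit Types (g : 'rV[R]_n -> R) (Omega : set 'rV[R]_n).

Definition iter_partial (s : seq 'I_n) g : 'rV[R]_n -> R :=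
  foldr (fun j h x => 'D_(delta_mx 0 j) h x) g s.

Definition smooth_fun g := forall s : seq 'I_n,
  continuous (iter_partial s g) /\
  forall j x, derivable (iter_partial s g) x (delta_mx 0 j).

(* Near each boundary point, up to the choice of the coordinate [i] and of its
   orientation [s], Omega lies on one side of the graph of a smooth function of
   the other coordinates. *)
Definition smooth_boundary Omega :=
  forall x0, (closure Omega `\` interior Omega) x0 ->
  exists (i : 'I_n) (s : bool) (g : 'rV[R]_n -> R),
    [/\ smooth_fun g,
        forall x y : 'rV[R]_n,
          (forall j, j != i -> x 0 j = y 0 j) -> g x = g y
      & \forall x \near x0, Omega x <-> 0 < (-1) ^+ s * (x 0 i - g x)].

End smooth_boundary.

Section operators.
Variables (R : realType) (H : preHilbertType R).

(* A possibly unbounded operator; the values of [act] outside [dom] are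
   irrelevant. *)
Record partial_op := PartialOp { dom : set H ; act :> H -> H }.
Implicit Types A B : partial_op.

Definition linear_op A := dom A 0 /\
  forall a u v, dom A u -> dom A v ->
    dom A (a *: u + v) /\ A (a *: u + v) = a *: A u + A v.

(* The graph of A coincides with the graph of its adjoint. *)
Definition self_adjoint A := forall v w,
  (dom A v /\ A v = w) <-> (forall u, dom A u -> dot (A u) v = dot u w).

Definition positive_op A := forall u, dom A u -> u != 0 -> 0 < dot (A u) u.

Definition resolvent_set A : set R := [set l |
  exists B : {linear H -> H}, [/\ continuous B,
    forall v, dom A (B v) /\ A (B v) - l *: B v = v &
    forall u, dom A u -> B (A u - l *: u) = u]].

(* Only real spectral values are considered: the spectrum of a self-adjoint
   operator is real. *)
Definition spectrum A : set R := ~` resolvent_set A.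

Definition eigenspace_of A (l : R) : set H := [set u | dom A u /\ A u = l *: u].

Definition discrete_spectrum A := forall l, spectrum A l ->
  [/\ isolated (spectrum A) l,
      exists2 u, eigenspace_of A l u & u != 0 &
      exists (m : nat) (e : 'I_m -> H), forall u, eigenspace_of A l u ->
        exists c : 'I_m -> R, u = \sum_(i < m) c i *: e i].

End operators.

Record spectral_family (R : realType) (H : preHilbertType R) := SpectralFamily {
  spec_proj :> R -> {linear H -> H} ;
  spec_proj_sym : forall l u v,
    dot (spec_proj l u) v = dot u (spec_proj l v) ;
  spec_proj_min : forall l m u,
    spec_proj l (spec_proj m u) = spec_proj (Num.min l m) u ;
  spec_proj_rc : forall l u, spec_proj m u @[m --> l^'+] --> spec_proj l u ;
  spec_proj_ninfty : forall u, spec_proj m u @[m --> -oo] --> (0 : H) ;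
  spec_proj_pinfty : forall u, spec_proj m u @[m --> +oo] --> u
}.

Section spectral_calculus.
Variables (R : realType) (H : preHilbertType R) (E : spectral_family H).
Implicit Types (u v : H) (g : R -> R).

Definition spectral_cdf u (l : R) : R := dot (E l u) u.

Let spectral_cdfE u l : spectral_cdf u l = `|E l u| ^+ 2.
Proof.
by rewrite /spectral_cdf -dotuu -spec_proj_sym spec_proj_min minxx.
Qed.

Let spectral_cdf_nd u : nondecreasing (spectral_cdf u).
Proof.
move=> l m lm; rewrite !spectral_cdfE -subr_ge0.
suff -> : `|E m u| ^+ 2 - `|E l u| ^+ 2 = `|E m u - E l u| ^+ 2.
  exact: sqr_ge0.
have dotDr (x y z : H) : dot x (y + z) = dot x y + dot x z.
  by rewrite dotC dotDl !(dotC _ x).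
have dotNl (x y : H) : dot (- x) y = - dot x y by rewrite -scaleN1r dotZl mulN1r.
have dotNr (x y : H) : dot x (- y) = - dot x y by rewrite dotC dotNl dotC.
have Elm : dot (E l u) (E m u) = `|E l u| ^+ 2.
  by rewrite -spec_proj_sym spec_proj_min minC min_l// -spectral_cdfE.
rewrite -[in RHS]dotuu dotDl !dotDr !dotNl !dotNr dotuu dotuu.
by rewrite (dotC (E m u)) Elm; ring.
Qed.

Let spectral_cdf_rc u : right_continuous (spectral_cdf u).
Proof.
move=> l; rewrite (_ : spectral_cdf u = (fun m => `|E m u| ^+ 2)); last first.
  by apply/funext => m; rewrite spectral_cdfE.
by rewrite expr2; under eq_fun do rewrite expr2; apply: cvgM;
  apply: cvg_norm; exact: spec_proj_rc.
Qed.

HB.instance Definition _ u := isCumulative.Build R _ R (spectral_cdf u)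
  (@spectral_cdf_nd u) (@spectral_cdf_rc u).

Definition spectral_measure u := lebesgue_stieltjes_measure (spectral_cdf u).
HB.instance Definition _ u := Measure.on (spectral_measure u).

(* The integral of [g] against d<E_l u, v>, by polarization. *)
Definition spectral_integral g u v : R :=
  4^-1 * (\int[spectral_measure (u + v)]_l g l
          - \int[spectral_measure (u - v)]_l g l).

(* [B] is the operator g(A), where A is the operator with resolution of the
   identity [E]. *)
Definition spectral_function g (B : partial_op H) :=
  dom B = [set u | (\int[spectral_measure u]_l ((g l) ^+ 2)%:E < +oo)%E] /\
  forall u v, dom B u -> dom B v -> dot (B u) v = spectral_integral g u v.

(* A is the integral of l dE_l. *)
Definition resolution_of_identity (A : partial_op H) := spectral_function id A.

Definition sob_sqnorm (s : R) u : \bar R :=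
  (\int[spectral_measure u]_(l in `[0%R, +oo[) ((1 + l ^+ 2) `^ s)%:E)%E.

Definition sobolev (s : R) : set H := [set u | (sob_sqnorm s u < +oo)%E].

End spectral_calculus.

Section parabolic.
Variables (R : realType) (H : preHilbertType R) (E : spectral_family H).
Variables (A : partial_op H) (T : R).
Local Notation leb := (@lebesgue_measure R).

(* Bochner measurability on ]0, T[ with values in H^1, for everywhere defined
   representatives. *)
Definition strongly_measurable (u : R -> H) :=
  exists s : nat -> R -> H,
    (forall k, [/\ finite_set (range (s k)),
       forall x, measurable (s k @^-1` [set x]) &
       forall t, sobolev E 1 (s k t)]) /\
    forall t, t \in `]0, T[ ->
      sob_sqnorm E 1 (s k t - u t) @[k --> \oo] --> 0%E.

Definition L2_H1 (u : R -> H) :=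
  [/\ forall t, t \in `]0, T[ -> sobolev E 1 (u t),
      strongly_measurable u &
      (\int[leb]_(t in `]0%R, T[) sob_sqnorm E 1 (u t) < +oo)%E].

Definition test_function (theta : R -> R) :=
  (forall k t, derivable (derive1n k theta) t 1) /\
  exists a b, [/\ 0 < a, b < T &
    forall t, theta t != 0 -> a <= t <= b].

(* The derivative [w] takes its values in H^(-1), whose elements are
   represented as functionals on H^1. *)
Definition weak_derivative (u : R -> H) (w : R -> H -> R) :=
  forall psi theta, sobolev E 1 psi -> test_function theta ->
    \int[leb]_(t in `]0, T[) (dot (u t) psi * derive1 theta t) =
    - \int[leb]_(t in `]0, T[) (w t psi * theta t).

(* A^2 as an operator from H^1 to its dual H^(-1): H^1 is the domain of A and
   the pairing of A^2 v with psi is the inner product of A v and A psi. *)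
Definition square_op (v psi : H) : R := dot (A v) (A psi).

(* The equation is d/dt u = - A^2 u in the sense of H^(-1)-valued distributions;
   it forces d/dt u to be in L^2(0, T; H^(-1)). *)
Definition Vp : set (R -> H) := [set u |
  L2_H1 u /\ weak_derivative u (fun t psi => - square_op (u t) psi)].

(* The value at t0 of the representative of [u] in C([0, T]; H). *)
Definition trace_at (u : R -> H) (t0 : R) (h : H) :=
  exists w : R -> H, [/\ {within `[0, T], continuous w},
    {ae leb, forall t, t \in `]0, T[ -> u t = w t} & w t0 = h].

End parabolic.

Definition affine_op (R : realType) (H : preHilbertType R) (expA : partial_op H)
  (gamma : R) (f phi : H) : H := (phi - gamma *: expA phi) + gamma *: f.

Definition L2_domain (R : realType) (n : nat) (Omega : set 'rV[R]_n)
    (oOmega : open Omega) : preHilbertType R :=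
  LspaceType2 (mrestr (@lebesgue_Rn R n) (open_measurable_Rn oOmega)).

(* Main.v *)
Require Import Defs.
From HB Require Import structures.
From mathcomp Require Import all_boot all_order all_algebra.
From mathcomp Require Import all_classical all_reals all_analysis.
From mathcomp Require Import measurable_realfun ring lra.

Set Implicit Arguments.
Unset Strict Implicit.
Unset Printing Implicit Defensive.

Import Order.TTheory GRing.Theory Num.Theory.
Import numFieldNormedType.Exports.

Local Open Scope classical_set_scope.
Local Open Scope ring_scope.

(** Why the iteration converges.  Put g(l) = exp(- l^2 T), so that expA = g(A).
Once f = expA u(0) is known, the error e_k = phi_k - u(0) obeys
e_(k+1) = (I - gamma expA) e_k.  The spectrum being discrete, everything can be
tested on eigenvectors: on the eigenspace of a spectral value l the error is
multiplied by 1 - gamma g(l) at each step, and |1 - gamma g(l)| < 1 because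
l >= inf sigma(A) >= 0 and gamma < 2 exp((inf sigma(A))^2 T).  These factors
approach 1 when l tends to infinity, so there is no contraction of the whole
space.  But every spectral component of the error only shrinks, hence the mass
of e_k outside a bounded spectral window is at most that of e_0, which is small
for a large window, while the mass inside the window tends to 0
([jump_contraction_cvg]).

Three facts carry this argument.

The resolution of the identity E grows only by jumps.  If u lies in the range
of E_b - E_a and |g - c| <= e on ]a, b], then |g(A) u - c u| <= e |u|
([spectral_function_band]).  Applied to A itself near a point l of the resolvent
set, this bound contradicts the boundedness of the inverse of A - l unless u = 0,
so E is locally constant on the resolvent set.  As the spectrum is made of
isolated points, near any l an increment (E_z - E_y) v is concentrated at l
([local_jump]), and the same bound makes it an eigenvector of every continuous
function of A ([jump_eigen]).  Local information of this kind is made global by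
[cousin], an additive form of the compactness of segments; in particular a
vector orthogonal to all jumps is 0 ([jump_total]).

The coefficients of the trajectory decay exponentially.  For an eigenvector psi
with eigenvalue l, the function c(t) = <u(t), psi> satisfies c' = - l^2 c in the
sense of distributions.  Inserting test functions of the form exp(l^2 t) eta(t)
turns this into the vanishing of the weak derivative of c(t) exp(l^2 t), so this
continuous function takes the same value at 0 and at T ([Vp_coefficient]).
Comparing with <expA u(0), psi> = g(l) <u(0), psi> on all jumps gives
f = expA u(0).

A continuous function with zero weak derivative takes equal values at both ends
([weak_constant]): otherwise a test function that climbs near 0, stays constant,
and descends near T gives a nonzero integral.  Such plateaus are composed from
the functions x^(-k) exp(-1/x), extended by 0 to x <= 0, whose closure under
algebraic operations, composition and exponentials is stable under
differentiation ([flat_algebra_derive]). *)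

(** * From local to global on a segment *)

(** The supremum of the x such that [P a x] holds must be [b]: the local
hypothesis at that supremum extends [P] past it.  The local hypothesis concerns
only subsegments of the segment from [a] to [b], so that a property of the
points of this segment can be exploited there. *)
Lemma cousin (R : realType) (P : R -> R -> Prop) (a b : R) :
  a <= b ->
  (forall x y z, x <= y -> y <= z -> P x y -> P y z -> P x z) ->
  (forall x, a <= x <= b -> exists2 d, 0 < d &
     forall y z, a <= y -> y <= z -> z <= b -> x - d < y -> z < x + d -> P y z) ->
  P a b.
Proof.
move=> ab Ptrans Ploc.
pose S := [set x | a <= x <= b /\ P a x].
have Sa : S a.
  split; first by rewrite lexx.
  have [|d d0] := Ploc a; first by rewrite lexx.
  by move=> Pd; apply: Pd; rewrite ?lexx// ?ltrBlDr ltrDl.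
have ubS : ubound S b by move=> x [/andP[]].
have supS : has_sup S by split; [exists a|exists b].
set s := sup S.
have as_ : a <= s by apply: sup_upper_bound.
have sb : s <= b by apply: ge_sup => //; exists a.
have [|d d0 Pd] := Ploc s; first by rewrite as_ sb.
have [x [/andP[ax xb] Pax] sx] := sup_adherent d0 supS.
have xs : x <= s by apply: sup_upper_bound => //; split => //; rewrite ax xb.
pose z := Num.min b (s + d / 2).
have sz : s <= z by rewrite le_min sb/= lerDl divr_ge0// ltW.
have zb : z <= b by rewrite ge_min lexx.
have zd : z < s + d by rewrite gt_min; apply/orP; right; rewrite ltrD2l; lra.
have Paz : P a z.
  apply: (Ptrans _ x) => //; first exact: le_trans sz.
  by apply: Pd => //; exact: le_trans sz.
have zs : z <= s.
  by apply: sup_upper_bound => //; split => //; rewrite (le_trans as_ sz).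
suff <- : z = b by [].
apply/eqP; rewrite eq_le zb/= leNgt; apply/negP => zltb.
have [bs|/ltW sb'] := leP b (s + d / 2).
  by move: zltb; rewrite /z min_l// ltxx.
by move: zs; rewrite /z min_r// leNgt ltrDl divr_gt0.
Qed.

(** * Inner products *)

Section inner_product.
Variables (R : realType) (H : preHilbertType R).
Implicit Types (u v w x y : H).

Lemma dotDr u v w : dot u (v + w) = dot u v + dot u w.
Proof. by rewrite dotC dotDl !(dotC _ u). Qed.

Lemma dotZr a u v : dot u (a *: v) = a * dot u v.
Proof. by rewrite dotC dotZl dotC. Qed.

Lemma dotNl u v : dot (- u) v = - dot u v.
Proof. by rewrite -scaleN1r dotZl mulN1r. Qed.

Lemma dotNr u v : dot u (- v) = - dot u v.
Proof. by rewrite dotC dotNl dotC. Qed.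

Lemma dotBl u v w : dot (u - v) w = dot u w - dot v w.
Proof. by rewrite dotDl dotNl. Qed.

Lemma dotBr u v w : dot u (v - w) = dot u v - dot u w.
Proof. by rewrite dotDr dotNr. Qed.

Lemma dot0l u : dot 0 u = 0.
Proof. by rewrite -(scale0r 0) dotZl mul0r. Qed.

Lemma dot0r u : dot u 0 = 0.
Proof. by rewrite dotC dot0l. Qed.

Lemma dot_normD u v : `|u + v| ^+ 2 = `|u| ^+ 2 + 2 * dot u v + `|v| ^+ 2.
Proof. by rewrite -!dotuu dotDl !dotDr (dotC v u); ring. Qed.

Lemma dot_normB u v : `|u - v| ^+ 2 = `|u| ^+ 2 - 2 * dot u v + `|v| ^+ 2.
Proof. by rewrite dot_normD dotNr normrN mulrN. Qed.

Lemma dot_polarization u v : dot u v = 4^-1 * (`|u + v| ^+ 2 - `|u - v| ^+ 2).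
Proof. by rewrite dot_normD dot_normB; field. Qed.

Lemma dot_le_norm u v : dot u v <= `|u| * `|v|.
Proof.
have [->|u0] := eqVneq u 0; first by rewrite dot0l normr0 mul0r.
have [->|v0] := eqVneq v 0; first by rewrite dot0r normr0 mulr0.
have := sqr_ge0 `| `|v| *: u - `|u| *: v |.
rewrite dot_normB dotZl dotZr !normrZ !normr_id.
have : 0 < `|u| * `|v| by rewrite mulr_gt0 ?normr_gt0.
move: (`|u|) (`|v|) (dot u v) => a b c ab h.
rewrite -(ler_pM2l ab); nra.
Qed.

Lemma continuous_dotl v : continuous (fun u => dot u v).
Proof.
move=> u; rewrite (_ : (fun _ => _) =
    (fun u => 4^-1 * (`|u + v| ^+ 2 - `|u - v| ^+ 2))); last first.
  by apply/funext => w; exact: dot_polarization.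
apply: cvgM; first exact: cvg_cst.
by apply: cvgB; apply: cvgM; apply: cvg_norm;
  [apply: cvgD|apply: cvgD|apply: cvgB|apply: cvgB];
  solve [exact: cvg_id|exact: cvg_cst].
Qed.

(** The hypothesis extends from [D] to all [w] by continuity, and [w := e^-1 *: y]
then gives the optimal bound.  The quadratic form of the hypothesis is the one
that polarization produces. *)
Lemma dense_norm_le (D : set H) (e : R) u y : dense D -> 0 < e ->
  (forall w, D w -> 2 * dot y w <= e * (`|u| ^+ 2 + `|w| ^+ 2)) ->
  `|y| <= e * `|u|.
Proof.
move=> dD e0 yD.
pose g w := 2 * dot w y - e * (`|u| ^+ 2 + `|w| ^+ 2).
have cg : continuous g.
  move=> w; apply: cvgB; apply: cvgM.
  - exact: cvg_cst.
  - exact: continuous_dotl.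
  - exact: cvg_cst.
  - apply: cvgD; first exact: cvg_cst.
    by apply: cvgM; apply: cvg_norm; exact: cvg_id.
have gle w : g w <= 0.
  rewrite leNgt; apply/negP => gw.
  have oO : open [set w | 0 < g w].
    apply: (@open_comp _ _ g [set r | 0 < r]) => [z _|]; [exact: cg|exact: open_gt].
  have [z [/= gz Dz]] := dD _ (ex_intro _ w gw) oO.
  by move: gz; rewrite /g subr_gt0 ltNge dotC yD.
have := gle (e^-1 *: y); rewrite /g dotZl dotuu normrZ gtr0_norm ?invr_gt0//.
rewrite exprMn subr_le0 => h.
rewrite -(@ler_pXn2r _ 2)// ?nnegrE ?mulr_ge0 ?(ltW e0)//.
rewrite exprMn; move: h; rewrite mulrDr.
rewrite (_ : e * (e^-1 ^+ 2 * `|y| ^+ 2) = e^-1 * `|y| ^+ 2); last first.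
  by field; rewrite gt_eqF.
rewrite (_ : 2 * (e^-1 * `|y| ^+ 2) = e^-1 * `|y| ^+ 2 + e^-1 * `|y| ^+ 2); last by ring.
by rewrite lerD2r mulrC ler_pdivrMr// mulrAC -expr2.
Qed.

End inner_product.

(** * The resolution of the identity and its spectral measures *)

Section projections.
Variables (R : realType) (H : preHilbertType R) (E : spectral_family H).
Implicit Types (u v w x y : H) (a b l m : R).

Lemma proj_le l m u : l <= m -> E l (E m u) = E l u.
Proof. by move=> lm; rewrite spec_proj_min min_l. Qed.

Lemma proj_ge l m u : m <= l -> E l (E m u) = E m u.
Proof. by move=> lm; rewrite spec_proj_min min_r. Qed.

Lemma projC l m u : E l (E m u) = E m (E l u).
Proof. by rewrite !spec_proj_min minC. Qed.

Lemma cdf_norm u l : spectral_cdf E u l = `|E l u| ^+ 2.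
Proof. by rewrite /spectral_cdf -dotuu -spec_proj_sym proj_le. Qed.

Lemma proj_norm_le l u : `|E l u| <= `|u|.
Proof.
have [->|e0] := eqVneq (E l u) 0; first by rewrite normr0.
have := dot_le_norm (E l u) u.
by rewrite -/(spectral_cdf E u l) cdf_norm expr2 ler_pM2l ?normr_gt0.
Qed.

Lemma norm_projB a b u : a <= b ->
  `|E b u - E a u| ^+ 2 = `|E b u| ^+ 2 - `|E a u| ^+ 2.
Proof.
move=> ab; rewrite dot_normB -spec_proj_sym proj_le//.
by rewrite -/(spectral_cdf E u a) cdf_norm; ring.
Qed.

(** [u] belongs to the range of the spectral projection [E b - E a] of the band
]a, b]. *)
Definition in_band a b u := E a u = 0 /\ E b u = u.

Lemma in_bandB a b u : a <= b -> in_band a b (E b u - E a u).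
Proof.
move=> ab; split; rewrite linearB/= (proj_le _ (lexx _)).
  by rewrite (proj_le _ ab) subrr.
by rewrite (proj_ge _ ab).
Qed.

Lemma in_bandD a b u v : in_band a b u -> in_band a b v -> in_band a b (u + v).
Proof. by move=> [u0 u1] [v0 v1]; split; rewrite linearD/= ?u0 ?v0 ?addr0// u1 v1. Qed.

Lemma in_bandN a b u : in_band a b u -> in_band a b (- u).
Proof. by move=> [u0 u1]; split; rewrite linearN/= ?u0 ?oppr0// u1. Qed.

(** What remains of [w] after removing its component in the band is orthogonal
to the band and to all its images by the projections [E m]. *)
Lemma in_band_orth a b u w m : a <= b -> in_band a b u ->
  dot (E m u) (w - (E b w - E a w)) = 0.
Proof.
move=> ab [u0 u1]; have [ub ub0] : E b (E m u) = E m u /\ E a (E m u) = 0.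
  by rewrite !(projC _ m) u0 u1 linear0.
by rewrite dotBr dotBr -!(spec_proj_sym _ _ (E m u)) ub ub0 dot0l subr0 subrr.
Qed.

End projections.

Section spectral_measures.
Variables (R : realType) (H : preHilbertType R) (E : spectral_family H).
Implicit Types (u v w x y : H) (a b l m : R) (g : R -> R).

Lemma spectral_measure_itv u a b : a <= b ->
  spectral_measure E u `]a, b]%classic =
    (spectral_cdf E u b - spectral_cdf E u a)%:E.
Proof.
move=> ab; rewrite /spectral_measure /lebesgue_stieltjes_measure /measure_extension.
rewrite measurable_mu_extE; last exact: is_ocitv.
by rewrite /= wlength_itv_bnd.
Qed.

Lemma spectral_measure_unique u (mu : {measure set (measurableTypeR R) -> \bar R}) :
  (forall a b, a <= b -> mu `]a, b]%classic =
    (spectral_cdf E u b - spectral_cdf E u a)%:E) ->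
  forall A, measurable A -> spectral_measure E u A = mu A.
Proof.
move=> muE; apply: lebesgue_stieltjes_measure_unique => X [[a b] _ <-] /=.
have [ab|ba] := leP a b; first by rewrite -/(spectral_measure E u) spectral_measure_itv// muE.
by rewrite set_itv_ge ?bnd_simp -?leNgt ?(ltW ba)// !measure0.
Qed.

(** The mass of the spectral window ]-k, k] exhausts the whole mass of [u]. *)
Lemma norm_window_cvg u :
  `|E k%:R u| ^+ 2 - `|E (- k%:R) u| ^+ 2 @[k --> \oo] --> `|u| ^+ 2.
Proof.
rewrite (_ : `|u| ^+ 2 = `|u| ^+ 2 - `|0 : H| ^+ 2); last first.
  by rewrite normr0 expr0n subr0.
have Ep : E k%:R u @[k --> \oo] --> u.
  by apply: (cvg_comp (fun k : nat => k%:R : R) (fun m => E m u) (@cvgr_idn R));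
    exact: spec_proj_pinfty.
have En : E (- k%:R) u @[k --> \oo] --> (0 : H).
  apply: (cvg_comp (fun k : nat => - k%:R : R) (fun m => E m u) _ (spec_proj_ninfty E u)).
  by apply/cvgNrNy; exact: cvgr_idn.
by apply: cvgB; apply: cvgM; apply: cvg_norm.
Qed.

Lemma spectral_measureT u : spectral_measure E u setT = (`|u| ^+ 2)%:E.
Proof.
pose F k : set (measurableTypeR R) := `]- (k%:R : R), k%:R]%classic.
have FT : \bigcup_k F k = setT.
  apply/seteqP; split => // x _; exists (Num.bound x) => //.
  by rewrite /F/= in_itv/= ltrNl unstable.ltrNbound ltW// unstable.ltr_bound.
have mF k : measurable (F k) by apply: measurable_itv.
have h : spectral_measure E u (F k) @[k --> \oo] --> spectral_measure E u setT.
  rewrite -FT; apply: nondecreasing_cvg_mu => //; first exact: bigcupT_measurable.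
  move=> m n mn; apply/subsetPset => x; rewrite /F/= !in_itv/= => /andP[xm xn].
  rewrite (le_lt_trans _ xm) ?lerN2 ?ler_nat// (le_trans xn)// ler_nat//.
have h' : spectral_measure E u (F k) @[k --> \oo] --> (`|u| ^+ 2)%:E.
  rewrite (_ : (fun k => _) =
      EFin \o (fun k => `|E k%:R u| ^+ 2 - `|E (- k%:R) u| ^+ 2)); last first.
    by apply/funext => k /=; rewrite spectral_measure_itv ?cdf_norm// lerNl ge0_cp.
  apply: cvg_EFin; first by apply: nearW => k.
  exact: norm_window_cvg.
exact: (cvg_unique _ h h').
Qed.

Lemma eq_spectral_measure u v : spectral_cdf E u =1 spectral_cdf E v ->
  forall A, measurable A -> spectral_measure E u A = spectral_measure E v A.
Proof.
by move=> uv; apply: spectral_measure_unique => a b ab; rewrite uv uv -spectral_measure_itv.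
Qed.

Lemma spectral_measureN u (A : set (measurableTypeR R)) : measurable A ->
  spectral_measure E (- u) A = spectral_measure E u A.
Proof.
by apply: eq_spectral_measure => l; rewrite !cdf_norm linearN normrN.
Qed.

(** The cross terms of the distribution function of [x + y] vanish, so this
function is the sum of those of [x] and [y]. *)
Lemma spectral_measureD x y : (forall m, dot (E m x) y = 0) ->
  forall A, measurable A -> spectral_measure E (x + y) A =
    measure_add (spectral_measure E x) (spectral_measure E y) A.
Proof.
move=> xy; apply: spectral_measure_unique => a b ab.
apply: (eq_trans (measure_addE (spectral_measure E x) (spectral_measure E y) _)).
apply: (eq_trans (congr2 adde (spectral_measure_itv x ab) (spectral_measure_itv y ab))).
apply: (congr1 EFin).
have yx m : dot (E m y) x = 0 by rewrite spec_proj_sym dotC.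
by rewrite /spectral_cdf !linearD/= !dotDl !dotDr !xy !yx; ring.
Qed.

End spectral_measures.

(** * Functions of A on a spectral band *)

Section spectral_integrals.
Variables (R : realType) (H : preHilbertType R) (E : spectral_family H).
Implicit Types (u v w x y : H) (a b l m : R).
Variable g : measurableTypeR R -> R.
Hypothesis mg : measurable_fun setT g.

Let mg2 : measurable_fun setT (fun l : measurableTypeR R => (g l ^+ 2)%:E).
Proof. by apply/measurable_EFinP; exact: measurable_funX. Qed.

(** Spectral measures are finite, so square integrability gives integrability,
through |g| <= 1 + g^2. *)
Lemma spectral_integrable u :
  (\int[spectral_measure E u]_l (g l ^+ 2)%:E < +oo)%E ->
  (spectral_measure E u).-integrable setT (EFin \o g).
Proof.
move=> g2; apply/integrableP; split; first exact/measurable_EFinP.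
apply: (@le_lt_trans _ _ (\int[spectral_measure E u]_l (1 + (g l ^+ 2)%:E))%E).
  apply: ge0_le_integral => //.
  - by apply/measurable_EFinP; exact: measurableT_comp.
  - exact: emeasurable_funD.
  - move=> l _; rewrite /= -EFinD lee_fin.
    have := sqr_ge0 (`|g l| - 1); rewrite -[g l ^+ 2]real_normK ?num_real//.
    by have := normr_ge0 (g l); nra.
rewrite ge0_integralD//; last by move=> l _; rewrite lee_fin sqr_ge0.
by rewrite integral_cst// mul1e [X in (X + _)%E](spectral_measureT E u) lte_add_pinfty// ltry.
Qed.

Lemma spectral_integralD x y : (forall m, dot (E m x) y = 0) ->
  (\int[spectral_measure E (x + y)%R]_l (g l ^+ 2)%:E < +oo)%E ->
  \int[spectral_measure E (x + y)]_l g l =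
  \int[spectral_measure E x]_l g l + \int[spectral_measure E y]_l g l.
Proof.
move=> xy g2.
have msE := spectral_measureD xy.
have : (\int[spectral_measure E (x + y)%R]_l (g l ^+ 2)%:E =
  \int[spectral_measure E x]_l (g l ^+ 2)%:E +
  \int[spectral_measure E y]_l (g l ^+ 2)%:E)%E.
  rewrite -ge0_integral_measure_add//; last by move=> l _; rewrite lee_fin sqr_ge0.
  by apply: eq_measure_integral => A mA _; exact: msE.
have x0 : (0 <= \int[spectral_measure E x]_l (g l ^+ 2)%:E)%E.
  by apply: integral_ge0 => l _; rewrite lee_fin sqr_ge0.
have y0 : (0 <= \int[spectral_measure E y]_l (g l ^+ 2)%:E)%E.
  by apply: integral_ge0 => l _; rewrite lee_fin sqr_ge0.
move=> g2E; rewrite g2E in g2.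
have ix : (spectral_measure E x).-integrable setT (EFin \o g).
  exact: spectral_integrable (le_lt_trans (leeDl _ y0) g2).
have iy : (spectral_measure E y).-integrable setT (EFin \o g).
  exact: spectral_integrable (le_lt_trans (leeDr _ x0) g2).
rewrite /Rintegral.
transitivity (fine (\int[measure_add (spectral_measure E x) (spectral_measure E y)]_l (g l)%:E)%E).
  by apply: (congr1 fine); apply: eq_measure_integral => A mA _; exact: msE.
rewrite integral_measure_add// fineD//; exact: integrable_fin_num.
Qed.

Lemma spectral_integralN x :
  \int[spectral_measure E (- x)]_l g l = \int[spectral_measure E x]_l g l.
Proof.
by apply: (congr1 fine); apply: eq_measure_integral => A mA _; exact: spectral_measureN.
Qed.

Section band.
Variables (a b c e : R).
Hypotheses (ab : a <= b) (e_gt0 : 0 < e)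
  (gc : forall l, a < l <= b -> `|g l - c| <= e).

Lemma spectral_measure_band u : in_band E a b u ->
  spectral_measure E u (~` `]a, b]%classic) = 0%E.
Proof.
move=> [u0 u1].
have mab : measurable (`]a, b]%classic : set (measurableTypeR R)).
  exact: measurable_itv.
have := spectral_measureT E u; rewrite -(setUv `]a, b]%classic).
rewrite measureU//; [|exact: measurableC|by rewrite setICr].
have mu_ab : spectral_measure E u `]a, b]%classic = (`|u| ^+ 2)%:E.
  by rewrite spectral_measure_itv// !cdf_norm u0 u1 normr0 expr0n subr0.
rewrite [X in (X + _)%E]mu_ab.
move/eqP; rewrite eq_sym addeC -sube_eq//; last by rewrite fin_num_adde_defl.
by rewrite subee// => /eqP.
Qed.

Lemma spectral_band_ae u : in_band E a b u ->
  {ae spectral_measure E u, forall l, a < l <= b}.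
Proof.
move=> bu; exists (~` `]a, b]%classic); split.
- by apply: measurableC; exact: measurable_itv.
- exact: spectral_measure_band.
- by move=> l /= h /=; apply: contra_not h; rewrite in_itv.
Qed.

Lemma spectral_band_dom u : in_band E a b u ->
  (\int[spectral_measure E u]_l (g l ^+ 2)%:E < +oo)%E.
Proof.
move=> bu; apply: (@le_lt_trans _ _
    (\int[spectral_measure E u]_l (cst ((`|c| + e) ^+ 2)%:E) l)%E).
  apply: ae_ge0_le_integral => //.
  - by move=> l _; rewrite lee_fin sqr_ge0.
  - by move=> l _; rewrite lee_fin sqr_ge0.
  apply: (@filterS _ _ (ae_filter_ringOfSetsType (spectral_measure E u)) _ _ _ (spectral_band_ae bu)) => l abl _.
  rewrite lee_fin -[leLHS]real_normK ?num_real//.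
  rewrite lerXn2r ?nnegrE ?addr_ge0// ?(ltW e_gt0)//.
  by rewrite -[g l](subrK c) addrC (le_trans (ler_normD _ _))// lerD2l gc.
by rewrite integral_cst// [X in (_ * X)%E](spectral_measureT E u) -EFinM ltry.
Qed.

(** The spectral measure of [u] lives on the band, where [g] is within [e] of
[c], and its total mass is the squared norm of [u]. *)
Lemma spectral_band_integral u : in_band E a b u ->
  `|\int[spectral_measure E u]_l g l - c * `|u| ^+ 2| <= e * `|u| ^+ 2.
Proof.
move=> bu.
have ig := spectral_integrable (spectral_band_dom bu).
have icst r : (spectral_measure E u).-integrable setT (EFin \o cst r).
  apply/integrableP; split => /=; first by apply/measurable_EFinP.
  rewrite [ltLHS](_ : _ = \int[spectral_measure E u]_l (cst `|r|%:E) l)%E// integral_cst//.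
  by rewrite [X in (_ * X)%E](spectral_measureT E u) -EFinM ltry.
have cstE r : \int[spectral_measure E u]_l (cst r) l = r * `|u| ^+ 2.
  by rewrite Rintegral_cst// [X in fine X](spectral_measureT E u).
have ih : (spectral_measure E u).-integrable setT (EFin \o (g \- cst c)).
  by have := integrableB measurableT ig (icst c).
rewrite -(cstE c) -(cstE e) -RintegralB// (le_trans (le_normr_Rintegral _ _))//.
apply: fine_le.
- by apply: integrable_fin_num => //; exact: (integrable_abse ih).
- exact: integrable_fin_num (icst e).
apply: ae_ge0_le_integral => //.
- by apply/measurable_EFinP; apply: measurableT_comp => //; exact: measurable_funB.
- by move=> l _; rewrite lee_fin ltW.
- by apply/measurable_EFinP.
apply: (@filterS _ _ (ae_filter_ringOfSetsType (spectral_measure E u)) _ _ _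
  (spectral_band_ae bu)) => l abl _.
by rewrite lee_fin gc.
Qed.

End band.
End spectral_integrals.

Section spectral_function_band.
Variables (R : realType) (H : preHilbertType R) (E : spectral_family H).
Variables (g : measurableTypeR R -> R) (B : partial_op H).
Hypotheses (mg : measurable_fun setT g) (Bg : spectral_function E g B).
Implicit Types (u v w x y : H) (a b l m : R).

Lemma spectral_functionC u v : dom B u -> dom B v -> dot (B u) v = dot u (B v).
Proof.
case: Bg => _ Bdot Bu Bv; rewrite (dotC u) (Bdot _ _ Bu Bv) (Bdot _ _ Bv Bu).
by rewrite /spectral_integral (addrC v u) -(opprB u v) (spectral_integralN E g (u - v)).
Qed.

Hypotheses (dB : dense (dom B))
  (BD : forall u v, dom B u -> dom B v -> dom B (u + v) /\ dom B (u - v)).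

(** In the notations of the proof below, the first two hypotheses estimate the
spectral integrals of u - p and u + p, and [i1] is the integral of w - p. *)
Let polarization_bound (i1 i2 i3 c e U D P W : R) :
  - (e * (U + 2 * - D + P)) <= i3 - c * (U + 2 * - D + P) ->
  i2 - c * (U + 2 * D + P) <= e * (U + 2 * D + P) ->
  e * P <= e * W ->
  2 * (4^-1 * (i2 + i1 - (i3 + i1)) - c * D) <= e * (U + W).
Proof. lra. Qed.

(** [B u] is only known through its pairings with vectors [w] of the domain, and
these are polarized spectral integrals at [u + w] and [u - w].  Splitting [w]
into its component [p] in the band and the orthogonal remainder [w'], the
contributions of [w'] cancel, and those of [u + p] and [u - p] are governed by
the values of [g] on the band. *)
Lemma spectral_function_band a b c e u :
  a <= b -> 0 < e -> (forall l, a < l <= b -> `|g l - c| <= e) ->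
  in_band E a b u -> dom B u /\ `|B u - c *: u| <= e * `|u|.
Proof.
move=> ab e0 gc bu; have [domB Bdot] := Bg.
have domBu : dom B u by rewrite domB; exact: (spectral_band_dom mg ab e0 gc).
split=> //; apply: (dense_norm_le dB e0) => w domBw.
have [uDw uBw] := BD domBu domBw.
pose p := E b w - E a w; pose w' := w - p.
have bp : in_band E a b p by exact: in_bandB.
have uDwE : u + w = (u + p) + w' by rewrite /w' -addrA subrKC.
have uBwE : u - w = (u - p) + - w' by rewrite /w' (opprB w p) -addrA addKr.
have orth x m : in_band E a b x -> dot (E m x) w' = 0 by exact: in_band_orth.
have intD : \int[spectral_measure E (u + w)]_l g l =
    \int[spectral_measure E (u + p)]_l g l + \int[spectral_measure E w']_l g l.
  rewrite uDwE; apply: spectral_integralD => //.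
    by move=> m; apply: orth; exact: in_bandD.
  by rewrite -uDwE; move: uDw; rewrite domB.
have intB : \int[spectral_measure E (u - w)]_l g l =
    \int[spectral_measure E (u - p)]_l g l + \int[spectral_measure E w']_l g l.
  rewrite uBwE -(spectral_integralN E g w'); apply: spectral_integralD => //.
    move=> m; rewrite dotNr orth ?oppr0//.
    by apply: in_bandD => //; exact: in_bandN.
  by rewrite -uBwE; move: uBw; rewrite domB.
have := spectral_band_integral mg ab e0 gc (in_bandD bu bp).
have := spectral_band_integral mg ab e0 gc (in_bandD bu (in_bandN bp)).
have upw : dot u w = dot u p.
  have := orth u b bu; case: bu => _ ->.
  by rewrite /w' dotBr => /eqP; rewrite subr_eq0 => /eqP.
have pw : `|p| ^+ 2 <= `|w| ^+ 2.
  rewrite /p norm_projB// (@le_trans _ _ (`|E b w| ^+ 2))//.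
    by rewrite gerBl sqr_ge0.
  by rewrite lerXn2r ?nnegrE// proj_norm_le.
rewrite dotBl dotZl Bdot// /spectral_integral intD intB upw.
rewrite !ler_norml => /andP[h1 h2] /andP[h3 h4].
clearbody w' p.
have epw : e * `|p| ^+ 2 <= e * `|w| ^+ 2 by rewrite ler_pM2l.
move: h1 h2 h3 h4 epw; rewrite !dot_normD dotNr normrN.
move: (\int[_]_(_ in _) _) (\int[_]_(_ in _) _) (\int[_]_(_ in _) _).
move: (`|u| ^+ 2) (`|p| ^+ 2) (`|w| ^+ 2) (dot u p) => U P W D i1 i2 i3.
move=> h1 _ _ h4 h5; exact: (polarization_bound _ h1 h4 h5).
Qed.

End spectral_function_band.

(** * The resolution of the identity grows by jumps *)

Section jumps.
Variables (R : realType) (H : preHilbertType R) (E : spectral_family H).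
Implicit Types (u v w : H) (a b l m : R).

(** [u] lies in the range of the jump at [l] of the resolution of the identity,
that is, in the spectral subspace of the single point [l]. *)
Definition jump_at l u :=
  (forall m, m < l -> E m u = 0) /\ (forall m, l <= m -> E m u = u).

Lemma jump_at0 l : jump_at l 0.
Proof. by split => m _; rewrite linear0. Qed.

(** A vector jumping at [l] belongs to every band ]l - d / 2, l], on which [g] is
as close to [g l] as desired. *)
Lemma jump_eigen (g : R -> R) (B : partial_op H) l u :
  measurable_fun [set: measurableTypeR R] (g : measurableTypeR R -> R) ->
  {for l, continuous g} -> spectral_function E g B -> dense (dom B) ->
  (forall u v, dom B u -> dom B v -> dom B (u + v) /\ dom B (u - v)) ->
  jump_at l u -> dom B u /\ B u = g l *: u.
Proof.
move=> mg cg Bg dB BD [u0 u1].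
have key e : 0 < e -> dom B u /\ `|B u - g l *: u| <= e * `|u|.
  move=> e0; have /cvgrPdist_le/(_ e e0) := cg.
  move=> /nbhs_ballP[d /= d0 gd].
  apply: (spectral_function_band mg Bg dB BD (a := l - d / 2) (b := l)) => //.
  - by rewrite lerBlDr lerDl ltW// divr_gt0.
  - move=> m /andP[lm ml]; rewrite distrC; apply: gd.
    rewrite /ball/= ger0_norm ?subr_ge0// ltrBlDr.
    have : d / 2 < d by rewrite ltr_pdivrMr// ltr_pMr// ltr1n.
    by move: lm; rewrite ltrBlDr; lra.
  - by split; [apply: u0; rewrite ltrBlDr ltrDl divr_gt0|exact: u1].
split; first by have [] := key 1 ltr01.
apply/eqP; rewrite -subr_eq0 -normr_le0; apply/ler_addgt0Pl => e e0.
rewrite addr0.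
have [_ h] := key (e / (`|u| + 1)) ltac:(by rewrite divr_gt0// ltr_wpDl).
apply: (le_trans h); rewrite mulrAC ler_pdivrMr ?ltr_wpDl//.
by rewrite ler_pM2l// lerDl.
Qed.

Lemma proj_right_limit l d v c : 0 < d ->
  (forall m, l < m < l + d -> E m v = c) -> E l v = c.
Proof.
move=> d0 Ec.
have h : E m v @[m --> l^'+] --> c.
  apply: cvg_near_cst.
  near=> m; apply: Ec; apply/andP; split; near: m; first exact: nbhs_right_gt.
  by apply: nbhs_right_lt; rewrite ltrDl.
by apply: (cvg_unique _ _ h); [exact: norm_hausdorff|exact: spec_proj_rc].
Unshelve. all: by end_near. Qed.

Lemma proj_ninfty_limit (a : R) v c : (forall m, m <= a -> E m v = c) -> c = 0.
Proof.
move=> Ec.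
have h : E m v @[m --> -oo] --> c.
  apply: cvg_near_cst.
  near=> m; apply: Ec; near: m; apply: nbhs_ninfty_le; exact: num_real.
by apply: (cvg_unique _ h); [exact: norm_hausdorff|exact: spec_proj_ninfty].
Unshelve. all: by end_near. Qed.

Variable A : partial_op H.
Hypotheses (linA : linear_op A) (dA : dense (dom A)) (E_A : resolution_of_identity E A).

Lemma dom_addsub u v : dom A u -> dom A v -> dom A (u + v) /\ dom A (u - v).
Proof.
have [_ AD] := linA => du dv; split.
  by have [] := AD 1 u v du dv; rewrite scale1r.
by have [] := AD (-1) v u dv du; rewrite scaleN1r addrC.
Qed.

(** On the range of a band of half-width [d] around [l] the operator [A - l] has
norm at most [d]; with [d] smaller than the inverse of the norm of the resolvent
this forces the range to be 0. *)
Lemma resolvent_proj_constant l : resolvent_set A l ->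
  exists2 d, 0 < d & forall y z, y <= z -> l - d < y -> z < l + d ->
    forall v, E z v = E y v.
Proof.
move=> [B [/linear_bounded_continuous/linear_boundedP Bb _ BA]].
have [C [C0 BC]] : exists C, 0 < C /\ forall v, `|B v| <= C * `|v|.
  near (+oo : set_system R) => C; exists C; split; near: C => //.
  by apply: nbhs_pinfty_gt; exact: num_real.
have d0 : 0 < (2 * C)^-1 by rewrite invr_gt0 mulr_gt0.
exists (2 * C)^-1 => // y z yz ly zl v.
have [du] := spectral_function_band (c := l) (@measurable_id _ _ setT) E_A dA dom_addsub
  yz d0 ltac:(by move=> m /andP[ym mz]; rewrite ler_norml; lra) (in_bandB E v yz).
set u := E z v - E y v in du * => Au.
have : `|u| <= C * ((2 * C)^-1 * `|u|).
  by rewrite -{1}(BA _ du) (le_trans (BC _))// ler_pM2l.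
rewrite mulrA invfM mulrCA divff ?gt_eqF// mulr1 => u2.
apply/eqP; rewrite -subr_eq0 -normr_le0 -/u.
by have := normr_ge0 u; lra.
Unshelve. all: by end_near. Qed.

Lemma spectrum_free_proj a b v : a <= b ->
  (forall m, a <= m <= b -> ~ spectrum A m) -> E b v = E a v.
Proof.
move=> ab nsp; apply: (cousin (P := fun a b => E b v = E a v) ab) => [x y z _ _ ->//|x xab].
have [d d0 Ed] := resolvent_proj_constant (contrapT (nsp _ xab)).
by exists d => // y z _ yz _ ly zl; exact: Ed.
Qed.

(** By isolation, [E] is constant on each side of [l] in a neighbourhood of [l];
right continuity includes [l] in the right side, so the whole increment occurs
at [l]. *)
Lemma local_jump l : discrete_spectrum A ->
  exists2 d, 0 < d & forall y z, y <= z -> l - d < y -> z < l + d ->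
    forall v, jump_at l (E z v - E y v) /\ (spectrum A l \/ E z v = E y v).
Proof.
move=> discA; have [sl|] := pselect (spectrum A l); last first.
  move/contrapT/resolvent_proj_constant => [d d0 Ed].
  exists d => // y z yz ly zl v; rewrite (Ed _ _ yz ly zl v) subrr.
  by split; [exact: jump_at0|right].
have [[_ [V /nbhs_ballP[d /= d0 dV] Vl]] _ _] := discA l sl.
exists d => // y z yz ly zl v; split; last by left.
have away m : `|m - l| < d -> m != l -> ~ spectrum A m.
  move=> ml ne sm; have : (V `&` spectrum A) m.
    by split => //; apply: dV; rewrite /ball/= distrC.
  by rewrite Vl /= => me; rewrite me eqxx in ne.
have left m k : l - d < m -> m <= k -> k < l -> E k v = E m v.
  move=> lm mk kl; apply: spectrum_free_proj => // x /andP[mx xk].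
  apply: away; first by rewrite ltr_norml; lra.
  by rewrite lt_eqF// (le_lt_trans xk).
have right' m k : l < m -> m <= k -> k < l + d -> E k v = E m v.
  move=> lm mk kl; apply: spectrum_free_proj => // x /andP[mx xk].
  apply: away; first by rewrite ltr_norml; lra.
  by rewrite gt_eqF// (lt_le_trans lm).
have right m : l <= m -> m < l + d -> E m v = E l v.
  rewrite le_eqVlt => /predU1P[->//|lm] md; apply/esym.
  apply: (@proj_right_limit l (m - l)); first by rewrite subr_gt0.
  move=> k /andP[lk km]; apply/esym; apply: right' => //; lra.
have [zl'|lz] := ltP z l.
  by rewrite (left _ _ ly yz zl') subrr; exact: jump_at0.
have [yl|ly'] := ltP y l; last first.
  by rewrite !right ?subrr//; [exact: jump_at0|exact: le_lt_trans zl].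
split => m ml; rewrite linearB/=.
  rewrite (proj_le _ _ (le_trans (ltW ml) lz)).
  have [my|ym] := leP m y; first by rewrite proj_le// subrr.
  by rewrite (proj_ge _ _ (ltW ym)) (left _ _ ly (ltW ym))// subrr.
rewrite (proj_ge E v (le_trans (ltW yl) ml)); congr (_ - _).
have [zm|mz] := leP z m; first by rewrite proj_ge.
by rewrite proj_le ?(ltW mz)// !right//; exact: lt_trans zl.
Qed.

(** Discreteness makes every spectral value an eigenvalue, to which positivity
applies. *)
Lemma spectrum_gt0 l : positive_op A -> discrete_spectrum A -> spectrum A l -> 0 < l.
Proof.
move=> posA discA /discA[_ [u [du Au] u0] _].
have := posA u du u0; rewrite Au dotZl dotuu pmulr_lgt0//.
by rewrite exprn_gt0// normr_gt0.
Qed.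

(** There is no spectrum in ]-oo, 0], so [E] is constant there, equal to its limit
0 at -oo. *)
Lemma proj_le0 (m : R) v : positive_op A -> discrete_spectrum A -> m <= 0 -> E m v = 0.
Proof.
move=> posA discA m0; apply: (@proj_ninfty_limit m) => k km; apply/esym.
apply: spectrum_free_proj => // x /andP[_ xm] /spectrum_gt0-/(_ posA discA).
by rewrite ltNge (le_trans xm).
Qed.

End jumps.

(** * Testing vectors and iterations on jumps *)

Section eigenvector_tests.
Variables (R : realType) (H : preHilbertType R) (E : spectral_family H).
Variable A : partial_op H.
Hypotheses (linA : linear_op A) (dA : dense (dom A)) (E_A : resolution_of_identity E A)
  (discA : discrete_spectrum A).

Let window (u : H) (y z : R) := `|E z u| ^+ 2 - `|E y u| ^+ 2.

Let windowD u x y z : window u x z = window u x y + window u y z.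
Proof. by rewrite /window [RHS]addrC subrKA. Qed.

Let window_le u y z : window u y z <= `|u| ^+ 2.
Proof.
rewrite /window (@le_trans _ _ (`|E z u| ^+ 2))// ?gerBl ?sqr_ge0//.
by rewrite lerXn2r ?nnegrE// proj_norm_le.
Qed.

(** Each increment of [E] applied to [d] is locally a jump, orthogonal to [d] by
hypothesis; but its pairing with [d] is its own squared norm. *)
Lemma jump_total (d : H) :
  (forall l u, spectrum A l -> jump_at E l u -> dot d u = 0) -> d = 0.
Proof.
move=> d0; have wd0 y z : y <= z -> window d y z = 0.
  move=> yz; apply: (cousin (P := fun y z => window d y z = 0) yz).
    by move=> a b c _ _; rewrite (windowD _ a b c) => -> ->; rewrite addr0.
  move=> l _; have [e e0 loc] := local_jump linA dA E_A l discA.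
  exists e => // a b _ ab _ la bl.
  rewrite /window -norm_projB//; have [ju] := loc a b ab la bl d.
  case=> [sl|->]; last by rewrite subrr normr0 expr0n.
  have [ua ub] := in_bandB E d ab; set u := E b d - E a d in ju ua ub *.
  rewrite -dotuu {1}/u dotBl !spec_proj_sym ua ub dot0r subr0.
  exact: d0 ju.
apply/eqP; rewrite -normr_eq0 -sqrf_eq0.
have := @norm_window_cvg _ _ E d; rewrite (_ : (fun k => _) = cst 0); last first.
  by apply/funext => k; apply: wd0; rewrite lerNl ge0_cp.
move=> h; apply/eqP; apply: (cvg_unique _ h); [exact: norm_hausdorff|exact: cvg_cst].
Qed.

(** Near a spectral value [l] the increments of [E] applied to [e k] are
multiplied by [r l] at each step.  Hence the spectral mass of [e k] in any window
tends to 0 and never exceeds that of [e 0]; the second property bounds the mass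
outside a large window uniformly in [k]. *)
Lemma jump_contraction_cvg (r : R -> R) (e : nat -> H) :
  (forall l, spectrum A l -> `|r l| < 1) ->
  (forall l u k, spectrum A l -> jump_at E l u ->
     dot (e k.+1) u = r l * dot (e k) u) ->
  e k @[k --> \oo] --> (0 : H).
Proof.
move=> r1 er.
(* Both properties are additive in the window, as [cousin] requires. *)
pose P y z := (forall k, window (e k) y z <= window (e 0%N) y z) /\
  window (e k) y z @[k --> \oo] --> (0 : R).
have PE y z : y <= z -> P y z.
  move=> yz; apply: (cousin yz) => [a b c _ _ [ab1 ab2] [bc1 bc2]|l _].
    split=> [k|]; first by rewrite !(windowD _ a b c) lerD.
    by rewrite -[X in _ --> X]addr0; under eq_fun do rewrite (windowD _ a b c); exact: cvgD.
  have [d d0 loc] := local_jump linA dA E_A l discA.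
  exists d => // a b _ ab _ la bl.
  have [sl|nsl] := pselect (spectrum A l); last first.
    have w0 k : window (e k) a b = 0.
      rewrite /window -norm_projB//; have [_ [//|->]] := loc a b ab la bl (e k).
      by rewrite subrr normr0 expr0n.
    by split => [k|]; rewrite ?w0//; under eq_fun do rewrite w0; exact: cvg_cst.
  have uS k : E b (e k.+1) - E a (e k.+1) = r l *: (E b (e k) - E a (e k)).
    apply/eqP; rewrite -subr_eq0 -normr_eq0 -sqrf_eq0 -dotuu.
    set v := (X in dot _ X).
    rewrite dotBl dotZl !dotBl !spec_proj_sym -!dotBr.
    by have [ju _] := loc a b ab la bl v; rewrite (er l) // subrr.
  have wE k : window (e k) a b = (r l ^+ 2) ^+ k * window (e 0%N) a b.
    elim: k => [|k IH]; first by rewrite expr0 mul1r.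
    rewrite exprS -mulrA -IH /window -!norm_projB// uS normrZ exprMn.
    by rewrite real_normK ?num_real.
  have w0 : 0 <= window (e 0%N) a b by rewrite /window -norm_projB// sqr_ge0.
  have r2 : r l ^+ 2 < 1.
    by rewrite -real_normK ?num_real// exprn_ilt1// r1.
  split=> [k|].
    by rewrite wE ler_piMl// exprn_ile1 ?sqr_ge0// ltW.
  have : (r l ^+ 2) ^+ k * window (e 0%N) a b @[k --> \oo] -->
      0 * window (e 0%N) a b.
    apply: cvgM; last exact: cvg_cst.
    by apply: cvg_expr; rewrite ger0_norm// sqr_ge0.
  by rewrite mul0r; under eq_fun do rewrite -wE.
apply/norm_cvg0P/cvgrPdist_lt => eps eps0.
have eps2 : 0 < eps ^+ 2 / 2 by rewrite divr_gt0// exprn_gt0.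
have nn (n : nat) : - n%:R <= n%:R :> R by rewrite lerNl ge0_cp.
(* A window that contains all but a small part of the mass of [e 0]. *)
have [n Hn] : exists n : nat,
    `|e 0%N| ^+ 2 - window (e 0%N) (- n%:R) n%:R < eps ^+ 2 / 2.
  have /cvgrPdist_lt/(_ _ eps2) := @norm_window_cvg _ _ E (e 0%N).
  case=> n _ /(_ n (leqnn n)) /= h; exists n.
  by rewrite (le_lt_trans _ h)// ler_norm.
have [_ /cvgrPdist_lt/(_ _ eps2)] := PE _ _ (nn n).
apply: filterS => k; rewrite sub0r normrN => wk.
rewrite sub0r normrN normr_id -(@ltr_pXn2r _ 2)// ?nnegrE ?(ltW eps0)//.
suff : `|e k| ^+ 2 <= `|e 0%N| ^+ 2 - window (e 0%N) (- n%:R) n%:R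
    + window (e k) (- n%:R) n%:R.
  have := ler_norm (window (e k) (- n%:R) n%:R); lra.
apply: (cvgr_to_le (@norm_window_cvg _ _ E (e k))).
exists n => // m /= nm.
have mn : - m%:R <= - n%:R :> R by rewrite lerN2 ler_nat.
have nm' : n%:R <= m%:R :> R by rewrite ler_nat.
have := windowD (e k) (- m%:R) (- n%:R) m%:R; rewrite (windowD (e k) (- n%:R) n%:R).
have := windowD (e 0%N) (- m%:R) (- n%:R) m%:R; rewrite (windowD (e 0%N) (- n%:R) n%:R).
have := (PE _ _ mn).1 k; have := (PE _ _ nm').1 k.
have := window_le (e 0%N) (- m%:R) m%:R.
rewrite -/(window _ _ _); lra.
Qed.

End eigenvector_tests.

(** * The space H^1 *)

Section sobolev_facts.
Variables (R : realType) (H : preHilbertType R) (E : spectral_family H).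
Hypothesis E_le0 : forall (m : R) v, m <= 0 -> E m v = 0.
Implicit Types (u v : H).

Lemma spectral_measure_le0 u : spectral_measure E u `]-oo, 0]%classic = 0%E.
Proof.
pose F k : set (measurableTypeR R) := `]- (k%:R : R), 0]%classic.
have FE : `]-oo, (0 : R)]%classic = \bigcup_k F k.
  apply/seteqP; split => [x /=|x [k _]]; rewrite /F/= !in_itv/=.
    move=> x0; exists (Num.bound x) => //=; rewrite in_itv/= x0 andbT ltrNl.
    exact: unstable.ltrNbound.
  by case/andP.
apply/eqP; rewrite eq_le measure_ge0 andbT FE.
have mF k : measurable (F k) by exact: measurable_itv.
apply: (le_trans (measure_sigma_subadditive (spectral_measure E u) mF _ (@subset_refl _ _))).
  exact: bigcupT_measurable.
rewrite eseries0// => k _ _.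
by rewrite /F [LHS]spectral_measure_itv ?oppr_le0// !cdf_norm !E_le0 ?oppr_le0// normr0 expr0n subr0.
Qed.

(** The Sobolev norm integrates over [0, +oo[ only; as nothing is lost on the
negative half-line, it is the graph norm of [A]. *)
Lemma sob_sqnorm1E u : sob_sqnorm E 1 u =
  ((`|u| ^+ 2)%:E + \int[spectral_measure E u]_l (l ^+ 2)%:E)%E.
Proof.
have mS : measurable_fun [set: measurableTypeR R]
    (fun l : measurableTypeR R => ((l : R) ^+ 2)%:E).
  by apply/measurable_EFinP; apply: measurable_funX; exact: measurable_id.
transitivity (\int[spectral_measure E u]_l (1 + (l ^+ 2)%:E))%E; last first.
  rewrite ge0_integralD//; last by move=> l _; rewrite lee_fin sqr_ge0.
  by rewrite integral_cst// mul1e [X in (X + _)%E](spectral_measureT E u).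
rewrite (@ge0_negligible_integral _ _ _ _ setT (`]-oo, (0 : R)[%classic : set (measurableTypeR R)))//; last 3 first.
- exact: emeasurable_funD.
- by move=> l _; rewrite -EFinD lee_fin addr_ge0 ?sqr_ge0.
- apply: (subset_measure0 _ _ _ (spectral_measure_le0 u)).
  + exact: measurable_itv.
  + exact: measurable_itv.
  + by move=> l /=; rewrite !in_itv/=; exact: ltW.
rewrite setTD setCitvl; apply: eq_integral => l _.
by rewrite powRr1// addr_ge0// sqr_ge0.
Qed.

Lemma norm_le_sob u : ((`|u| ^+ 2)%:E <= sob_sqnorm E 1 u)%E.
Proof.
rewrite sob_sqnorm1E leeDl//; apply: integral_ge0 => l _.
by rewrite lee_fin sqr_ge0.
Qed.

Lemma sobolev1_dom (A : partial_op H) u : resolution_of_identity E A ->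
  sobolev E 1 u <-> dom A u.
Proof.
move=> [-> _]; rewrite /sobolev/= sob_sqnorm1E.
have i0 : (0 <= \int[spectral_measure E u]_l (l ^+ 2)%:E)%E.
  by apply: integral_ge0 => l _; rewrite lee_fin sqr_ge0.
split => h; last by rewrite lte_add_pinfty// ltry.
by apply: le_lt_trans h; rewrite leeDr// lee_fin sqr_ge0.
Qed.

Lemma measurable_simple_dot (s : R -> H) psi :
  finite_set (range s) -> (forall x, measurable (s @^-1` [set x])) ->
  measurable_fun setT (fun t : R => dot (s t) psi).
Proof.
move=> fs ms _ Y mY; rewrite setTI.
rewrite (_ : _ @^-1` _ =
    \bigcup_(x in range s `&` [set x | Y (dot x psi)]) (s @^-1` [set x])).
  by apply: fin_bigcup_measurable => //; exact: finite_setIl.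
by apply/seteqP; split=> [t /= Yt|t [x [_ /= Yx] /= ->//]]; exists (s t) => //.
Qed.

Lemma sob_cvg_dot (s : nat -> H) v psi :
  sob_sqnorm E 1 (s k - v) @[k --> \oo] --> 0%E ->
  dot (s k) psi @[k --> \oo] --> dot v psi.
Proof.
move=> sv.
have h : (`|s k - v| ^+ 2)%:E @[k --> \oo] --> 0%:E.
  apply: (squeeze_cvge (f := cst 0%:E) _ _ sv); last exact: cvg_cst.
  by apply: nearW => k; rewrite norm_le_sob lee_fin sqr_ge0.
suff sk : s k @[k --> \oo] --> v.
  exact: (cvg_comp s (fun x => dot x psi) sk (@continuous_dotl _ _ psi v)).
apply/cvgrPdist_lt => e e0.
have e2 : 0 < e ^+ 2 by rewrite exprn_gt0.
have h' : `|s k - v| ^+ 2 @[k --> \oo] --> (0 : R) by exact: (fine_cvg h).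
have /cvgrPdist_lt/(_ _ e2) := h'.
apply: filterS => k /=.
rewrite sub0r normrN ger0_norm ?sqr_ge0// (distrC (s k)).
by rewrite ltr_pXn2r ?nnegrE ?normr_ge0 ?(ltW e0).
Qed.

(** Convergence in H^1 is stronger than convergence in H, so the coefficients of
[u] are pointwise limits of those of simple functions. *)
Lemma measurable_dot (T : R) (u : R -> H) psi : strongly_measurable E T u ->
  measurable_fun `]0, T[%classic (fun t => dot (u t) psi).
Proof.
move=> [s [ss su]].
apply: (measurable_fun_cvg (h := fun k t => dot (s k t) psi)) => //.
  move=> k; have [fs ms _] := ss k.
  by apply: measurable_funTS; exact: measurable_simple_dot.
by move=> t t0T; apply: sob_cvg_dot; apply: su.
Qed.

End sobolev_facts.

(** * An algebra of smooth functions with flat points *)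

Section test_functions.
Variable R : realType.
Implicit Types (f g : R -> R) (x t c : R) (k : nat).

(** The classical function exp(-1/x), flat at 0; the factor x^(-k) makes the
family stable under differentiation. *)
Definition flat k x : R := if 0 < x then x^-1 ^+ k * expR (- x^-1) else 0.

Lemma flat_ge0 k x : 0 <= flat k x.
Proof.
by rewrite /flat; case: ifPn => // x0; rewrite mulr_ge0 ?expR_ge0// exprn_ge0 ?invr_ge0 ?ltW.
Qed.

Lemma flat_le0 k x : x <= 0 -> flat k x = 0.
Proof. by rewrite /flat leNgt => /negbTE ->. Qed.

(** With y = 1/x this is y^(k+2) <= (k+2)! exp(y).  It makes the difference
quotients at 0 tend to 0. *)
Lemma flat_quotient_le k x : `|x^-1 * flat k x| <= (k.+2)`!%:R * `|x|.
Proof.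
have [x0|x0] := ltP 0 x; last by rewrite flat_le0// mulr0 normr0 mulr_ge0.
have y0 : 0 < x^-1 by rewrite invr_gt0.
rewrite (gtr0_norm x0) ger0_norm; last by rewrite mulr_ge0 ?flat_ge0// ltW.
rewrite /flat x0 mulrA -exprS expRN -[x in leRHS]invrK -/(_ / _).
move: x^-1 y0 => y y0; rewrite -/(_ / _).
rewrite ler_pdivrMr ?expR_gt0// mulrAC ler_pdivlMr// -exprSr.
have := expR_ge1Dxn k.+1 (ltW y0).
rewrite -lerBrDl => h; rewrite mulrC -ler_pdivrMr ?ltr0n ?fact_gt0//.
by rewrite (le_trans h)// gerBl.
Qed.

Lemma flat_is_derive k x : is_derive x 1 (flat k) (flat k.+2 x - k%:R * flat k.+1 x).
Proof.
have [x0|x0|->] := ltgtP x 0.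
- rewrite !flat_le0 ?(ltW x0)// mulr0 subr0.
  apply: (near_eq_is_derive (f := cst 0)).
  by near=> y; rewrite flat_le0// ltW//; near: y; exact: lt_nbhsl.
- have -> : flat k.+2 x - k%:R * flat k.+1 x =
     x^-1 ^+ k *: (expR (- x^-1) * (- (- x ^- 2 *: 1))) +
     expR (- x^-1) *: ((k%:R * x^-1 ^+ k.-1) *: (- x ^- 2 *: 1)).
    rewrite /flat x0 !scaler1 /GRing.scale/= -exprVn.
    by case: k => [|k]/=; rewrite ?expr0 ?mul0r ?mulr0 !exprS; ring.
  have dV : is_derive x 1 (fun y : R => y^-1) (- x ^- 2 *: 1).
    by apply: is_deriveV; rewrite gt_eqF.
  have dE : is_derive x 1 (expR \o (- (fun y : R => y^-1)))
      (expR (- x^-1) * (- (- x ^- 2 *: 1))).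
    exact: is_derive1_comp.
  have := is_deriveM (is_deriveX k dV) dE; rewrite !fctE; apply: near_eq_is_derive.
  near=> y; have y0 : 0 < y by near: y; exact: lt_nbhsr.
  by rewrite /flat y0.
rewrite !flat_le0 ?mulr0 ?subr0//.
have h : (fun h : R => h^-1 *: ((flat k \o shift 0) (h *: (1 : R)) - flat k 0)) @ 0^' --> (0 : R).
  apply/cvgrPdist_le => e e0; near=> h => /=.
  rewrite sub0r normrN (flat_le0 k (lexx 0)) subr0 addr0 [h *: 1]mulr1.
  apply: (le_trans (flat_quotient_le k h)).
  rewrite mulrC -ler_pdivlMr ?ltr0n ?fact_gt0//.
  near: h; apply: dnbhs0_le; rewrite divr_gt0// ltr0n fact_gt0//.
apply: DeriveDef; first by apply/cvg_ex; exists 0.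
exact: cvg_lim h.
Unshelve. all: by end_near. Qed.

(** Smoothness of the functions used below follows from membership in a class
that contains the derivatives of its members. *)
Inductive flat_algebra : (R -> R) -> Prop :=
| flat_algebra_cst c : flat_algebra (cst c)
| flat_algebra_id : flat_algebra id
| flat_algebra_add f g : flat_algebra f -> flat_algebra g ->
    flat_algebra (fun x => f x + g x)
| flat_algebra_mul f g : flat_algebra f -> flat_algebra g ->
    flat_algebra (fun x => f x * g x)
| flat_algebra_exp f : flat_algebra f -> flat_algebra (fun x => expR (f x))
| flat_algebra_flat k f : flat_algebra f -> flat_algebra (fun x => flat k (f x)).

Lemma flat_algebra_derive f : flat_algebra f ->
  exists2 df, flat_algebra df & forall x, is_derive x 1 f (df x).
Proof.
elim => {f} [c||f g _ [df Adf Df] _ [dg Adg Dg]|f g Af [df Adf Df] Ag [dg Adg Dg]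
  |f Af [df Adf Df]|k f Af [df Adf Df]].
- by exists (cst 0) => [|x]; [exact: flat_algebra_cst|exact: is_derive_cst].
- by exists (cst 1) => [|x]; [exact: flat_algebra_cst|exact: is_derive_id].
- by exists (fun x => df x + dg x) => [|x]; [exact: flat_algebra_add|exact: is_deriveD].
- exists (fun x => f x * dg x + g x * df x) => [|x]; last exact: is_deriveM.
  by apply: flat_algebra_add; exact: flat_algebra_mul.
- exists (fun x => expR (f x) * df x) => [|x]; last exact: is_derive1_comp.
  by apply: flat_algebra_mul => //; exact: flat_algebra_exp.
- exists (fun x => (flat k.+2 (f x) + - k%:R * flat k.+1 (f x)) * df x) => [|x].
    apply: flat_algebra_mul => //; apply: flat_algebra_add; first exact: flat_algebra_flat.
    by apply: flat_algebra_mul; [exact: flat_algebra_cst|exact: flat_algebra_flat].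
  rewrite mulNr; apply: (@is_derive1_comp _ (flat k) f) => //; exact: flat_is_derive.
Qed.

Lemma flat_algebra_derivable f x : flat_algebra f -> derivable f x 1.
Proof. by move=> /flat_algebra_derive[df _ /(_ x)[]]. Qed.

Lemma flat_algebra_derive1 f : flat_algebra f -> flat_algebra (f^`())%classic.
Proof.
move=> /flat_algebra_derive[df Adf Df].
rewrite (_ : (f^`())%classic = df)//; apply/funext => x.
by rewrite derive1E; have [_ ->] := Df x.
Qed.

Lemma flat_algebra_derive1n f k : flat_algebra f -> flat_algebra (derive1n k f).
Proof.
by move=> Af; elim: k => [//|k IH]; rewrite derive1nS; exact: flat_algebra_derive1.
Qed.

Lemma flat_algebra_continuous f : flat_algebra f -> continuous f.
Proof.
by move=> Af x; apply/differentiable_continuous/derivable1_diffP/flat_algebra_derivable.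
Qed.

End test_functions.

(** * Continuous functions with zero weak derivative *)

Section weak_constancy.
Variable R : realType.
Implicit Types (f g G eta : R -> R) (x t : R).
Local Notation leb := (@lebesgue_measure R).

(** A smooth function that decreases from a positive constant on ]-oo, 0] to 0 on
[1, +oo[: the inner function reaches the threshold [flat 0 1] at 1, where the
outer one becomes flat. *)
Definition step x : R := flat 0 (flat 0 1 - flat 0 x).

(** The opposite of the derivative of [step]. *)
Definition dstep x : R := flat 2 (flat 0 1 - flat 0 x) * flat 2 x.

Let height : R := flat 0 (flat 0 1).

Let height_gt0 : 0 < height.
Proof.
have f1 : 0 < flat 0 (1 : R) by rewrite /flat ltr01 mulr_gt0 ?expR_gt0// exprn_gt0// invr1.
by rewrite /height [X in _ < X]/flat f1 mulr_gt0 ?expR_gt0// exprn_gt0// invr_gt0.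
Qed.

Lemma step_le0 x : x <= 0 -> step x = height.
Proof. by move=> x0; rewrite /step (flat_le0 _ x0) subr0. Qed.

Let flat0_ge1 x : 1 <= x -> flat 0 (1 : R) - flat 0 x <= 0.
Proof.
move=> x1; have x0 : 0 < x by exact: lt_le_trans x1.
rewrite /flat ltr01 x0 !expr0 !mul1r subr_le0 ler_expR lerN2 invr1.
by rewrite invf_le1.
Qed.

Lemma step_ge1 x : 1 <= x -> step x = 0.
Proof. by move=> /flat0_ge1 x1; rewrite /step flat_le0. Qed.

Lemma dstep_ge0 x : 0 <= dstep x.
Proof. by rewrite mulr_ge0// flat_ge0. Qed.

Lemma dstep_le0 x : x <= 0 -> dstep x = 0.
Proof. by move=> x0; rewrite /dstep (flat_le0 2 x0) mulr0. Qed.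

Lemma step_affine_algebra a b : flat_algebra (fun t : R => step (a + b * t)).
Proof.
apply: flat_algebra_flat; apply: flat_algebra_add; first exact: flat_algebra_cst.
have -> : (fun t : R => - flat 0 (a + b * t)) = (fun t => -1 * flat 0 (a + b * t)).
  by apply/funext => t; rewrite mulN1r.
apply: flat_algebra_mul; first exact: flat_algebra_cst.
apply: flat_algebra_flat; apply: flat_algebra_add; first exact: flat_algebra_cst.
apply: flat_algebra_mul; first exact: flat_algebra_cst.
exact: flat_algebra_id.
Qed.

Lemma step_affine_is_derive a b t :
  is_derive t 1 (fun t : R => step (a + b * t)) (- b * dstep (a + b * t)).
Proof.
have daff : is_derive t 1 (fun t : R => a + b * t) b.
  have := is_deriveD (is_derive_cst a t 1) (is_deriveZ b (is_derive_id t (1 : R))).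
  by rewrite add0r [b *: 1]mulr1.
have dflat k x : is_derive x 1 (flat k) (flat k.+2 x - k%:R * flat k.+1 x).
  exact: flat_is_derive.
have dstep_ x : is_derive x 1 step (- dstep x).
  apply: (is_derive_eq (@is_derive1_comp _ (flat 0) (fun x => flat 0 1 - flat 0 x) x _ _
    (dflat 0 _) (is_deriveB (is_derive_cst _ _ _) (dflat 0 x)))).
  by rewrite /dstep; ring.
apply: (is_derive_eq
  (@is_derive1_comp _ step (fun t : R => a + b * t) t _ _ (dstep_ _) daff)).
by ring.
Qed.

Lemma continuous_integrable_oo f (T : R) : {within `[0, T], continuous f} ->
  leb.-integrable `]0, T[%classic (EFin \o f).
Proof.
move=> cf; have I : leb.-integrable `[0, T]%classic (EFin \o f).
  by apply: continuous_compact_integrable => //; exact: segment_compact.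
by apply: integrableS I => //; exact: subset_itv_oo_cc.
Qed.

Lemma flat_algebra_FTC F (T : R) : 0 < T -> flat_algebra F ->
  \int[leb]_(t in `]0, T[) (F^`())%classic t = F T - F 0.
Proof.
move=> T0 AF.
have cF' := flat_algebra_continuous (flat_algebra_derive1 AF).
have cF'w : {within `[0, T], continuous (F^`())%classic}.
  exact: continuous_subspaceT.
have iF' := continuous_integrable_oo cF'w.
rewrite /Rintegral -(integral_itv_bndoo true false); last exact: (measurable_int leb).
rewrite (continuous_FTC2 (F := F) T0 cF'w)//; split.
- by move=> x _; exact: flat_algebra_derivable.
- exact/cvg_at_right_filter/flat_algebra_continuous.
- exact/cvg_at_left_filter/flat_algebra_continuous.
Qed.

Lemma within_near (G : R -> R) (T x : R) (P : set R) : x \in `[0, T] ->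
  {within `[0, T], continuous G} -> nbhs (G x) P ->
  exists2 d, 0 < d & forall t, t \in `[0, T] -> `|x - t| < d -> P (G t).
Proof.
move=> xT /subspace_continuousP/(_ x xT) Gx GP.
have /nbhs_ballP[d /= d0 h] : nbhs x [set t | `[0, T]%classic t -> P (G t)] := Gx P GP.
by exists d => // t tT xt; apply: h.
Qed.

(** Suppose G(0) < m1 < m2 < G(T).  The test function [eta] is a plateau: its
derivative is nonnegative and supported where G < m1, near 0, then nonpositive
and supported where G > m2, near T.  Hence the integral of G eta' is at most
(m1 - m2) times the height of the plateau, which is negative. *)
Lemma weak_increase_absurd G (T : R) : 0 < T -> {within `[0, T], continuous G} ->
  (forall eta a b, flat_algebra eta -> 0 < a -> b < T ->
     (forall t, eta t != 0 -> a <= t <= b) ->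
     \int[leb]_(t in `]0, T[) (G t * (eta^`())%classic t) = 0) ->
  G T <= G 0.
Proof.
move=> T0 cG Geta; rewrite leNgt; apply/negP => G0T.
pose m1 := G 0 + (G T - G 0) / 3; pose m2 := G T - (G T - G 0) / 3.
have [G0m m12 mGT] : [/\ G 0 < m1, m1 < m2 & m2 < G T].
  by rewrite /m1 /m2; split; lra.
have [||d0 d0_gt0 Gd0] := @within_near G T 0 [set y | y < m1] _ cG.
- by rewrite in_itv/= lexx ltW.
- exact: lt_nbhsl.
have [||d1 d1_gt0 Gd1] := @within_near G T T [set y | m2 < y] _ cG.
- by rewrite in_itv/= lexx ltW.
- exact: lt_nbhsr.
pose d := Num.min T (Num.min d0 d1) / 4.
have d_gt0 : 0 < d by rewrite divr_gt0// !lt_min T0 d0_gt0.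
have [dT dd0 dd1] : [/\ 4 * d <= T, 4 * d <= d0 & 4 * d <= d1].
  by rewrite /d mulrC divfK// !ge_min !lexx !orbT.
pose U t := step (2 + - d^-1 * t).
pose D t := step ((2 - T / d) + d^-1 * t).
(* Everywhere at least one of [U] and [D] equals [height], since [4 * d <= T]:
   subtracting it leaves a plateau that vanishes outside [[d, T - d]]. *)
pose eta t := U t + D t + - height.
(* The derivative of [F] dominates G eta', and its integral is explicit. *)
pose F t := m1 * U t + m2 * D t.
have AU : flat_algebra U by exact: step_affine_algebra.
have AD : flat_algebra D by exact: step_affine_algebra.
have Aeta : flat_algebra eta.
  by apply: flat_algebra_add (flat_algebra_cst _); exact: flat_algebra_add.
have AF : flat_algebra F.
  by apply: flat_algebra_add; apply: flat_algebra_mul => //; exact: flat_algebra_cst.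
have dU t : is_derive t 1 U (d^-1 * dstep (2 + - d^-1 * t)).
  by have := step_affine_is_derive 2 (- d^-1) t; rewrite opprK.
have dD t : is_derive t 1 D (- d^-1 * dstep ((2 - T / d) + d^-1 * t)).
  exact: step_affine_is_derive.
have deta t : (eta^`())%classic t =
    d^-1 * dstep (2 + - d^-1 * t) - d^-1 * dstep ((2 - T / d) + d^-1 * t).
  rewrite derive1E; apply: (@derive_val _ _ _ t 1 eta).
  apply: (is_derive_eq
    (is_deriveD (is_deriveD (dU t) (dD t)) (is_derive_cst (- height) t 1))).
  by ring.
have dF t : (F^`())%classic t =
    m1 * (d^-1 * dstep (2 + - d^-1 * t)) - m2 * (d^-1 * dstep ((2 - T / d) + d^-1 * t)).
  rewrite derive1E; apply: (@derive_val _ _ _ t 1 F).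
  apply: (is_derive_eq (is_deriveD (is_deriveZ m1 (dU t)) (is_deriveZ m2 (dD t)))).
  by rewrite /GRing.scale/=; ring.
have Uarg t : 2 + - d^-1 * t = (2 * d - t) / d by field; rewrite gt_eqF.
have Darg t : 2 - T / d + d^-1 * t = (t - (T - 2 * d)) / d by field; rewrite gt_eqF.
have U0 t : t <= d -> U t = 0.
  by move=> td; rewrite /U Uarg step_ge1// ler_pdivlMr// mul1r; lra.
have U1 t : 2 * d <= t -> U t = height.
  by move=> td; rewrite /U Uarg step_le0// ler_pdivrMr// mul0r; lra.
have D0 t : T - d <= t -> D t = 0.
  by move=> td; rewrite /D Darg step_ge1// ler_pdivlMr// mul1r; lra.
have D1 t : t <= T - 2 * d -> D t = height.
  by move=> td; rewrite /D Darg step_le0// ler_pdivrMr// mul0r; lra.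
have supp_eta t : eta t != 0 -> d <= t <= T - d.
  apply: contra_neqT; rewrite negb_and -!ltNge /eta => /orP[td|td].
    by rewrite U0 ?(ltW td)// D1 ?add0r ?subrr//; lra.
  by rewrite D0 ?(ltW td)// U1 ?addr0 ?subrr//; lra.
have ds_ge0 x : 0 <= d^-1 * dstep x.
  by apply: mulr_ge0 (dstep_ge0 x); rewrite invr_ge0 ltW.
have int0 := Geta eta d (T - d) Aeta d_gt0 ltac:(by rewrite ltrBlDr ltrDl) supp_eta.
have : \int[leb]_(t in `]0, T[) (G t * (eta^`())%classic t) <=
    \int[leb]_(t in `]0, T[) (F^`())%classic t.
  apply: le_Rintegral => //.
  - apply: (@continuous_integrable_oo (fun t => G t * (eta^`())%classic t)).
    move=> t; apply: cvgM; first exact: cG.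
    exact: (continuous_subspaceT (flat_algebra_continuous (flat_algebra_derive1 Aeta))).
  - apply: continuous_integrable_oo; apply: continuous_subspaceT.
    exact/flat_algebra_continuous/flat_algebra_derive1.
  move=> t; rewrite /= in_itv/= => /andP[t0 tT]; rewrite deta dF mulrBr lerB//.
    have [td|dt] := leP (2 * d) t.
      by rewrite Uarg dstep_le0 ?mulr0// ler_pdivrMr// mul0r; lra.
    apply: ler_wpM2r; first exact: ds_ge0.
    apply: ltW; apply: (Gd0 t); first by rewrite in_itv/=; lra.
    by rewrite sub0r normrN gtr0_norm//; lra.
  have [td|dt] := leP t (T - 2 * d).
    by rewrite Darg dstep_le0 ?mulr0// ler_pdivrMr// mul0r; lra.
  apply: ler_wpM2r; first exact: ds_ge0.
  apply: ltW; apply: (Gd1 t); first by rewrite in_itv/=; lra.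
  by rewrite ger0_norm; lra.
rewrite int0 flat_algebra_FTC// /F.
rewrite (U1 T) ?(D0 T) ?(U0 0) ?(D1 0); [|lra..].
by rewrite !mulr0 addr0 add0r -mulrBl pmulr_lge0// subr_ge0 leNgt m12.
Qed.

Lemma weak_constant G (T : R) : 0 < T -> {within `[0, T], continuous G} ->
  (forall eta a b, flat_algebra eta -> 0 < a -> b < T ->
     (forall t, eta t != 0 -> a <= t <= b) ->
     \int[leb]_(t in `]0, T[) (G t * (eta^`())%classic t) = 0) ->
  G T = G 0.
Proof.
move=> T0 cG Geta; apply/eqP; rewrite eq_le weak_increase_absurd//=.
rewrite -lerN2; apply: (@weak_increase_absurd (fun t => - G t)) => //.
  by move=> t; apply: cvgN; exact: cG.
move=> eta a b Aeta a0 bT supp.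
under eq_Rintegral do rewrite mulNr -mulN1r.
rewrite RintegralZl//; first by rewrite (Geta eta a b)// mulr0.
apply: (@continuous_integrable_oo (fun t => G t * (eta^`())%classic t)).
move=> t; apply: cvgM; first exact: cG.
exact: (continuous_subspaceT (flat_algebra_continuous (flat_algebra_derive1 Aeta))).
Qed.

End weak_constancy.

(** * Convergence of the iteration *)

Section parabolic_coefficients.
Variables (R : realType) (H : preHilbertType R) (E : spectral_family H).
Variables (A : partial_op H) (T : R).
Hypotheses (E_A : resolution_of_identity E A) (T_gt0 : 0 < T)
  (E_le0 : forall (m : R) v, m <= 0 -> E m v = 0).
Local Notation leb := (@lebesgue_measure R).

(** In the weak equation tested with [psi], the symmetry of [A] moves both copies
of [A] onto the eigenvector.  The resulting weak equation c' = - l^2 c is solved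
by the integrating factor exp(l^2 t), which is put into the test function.  The
measurability of the coefficients of [u] lets [u] be replaced by its continuous
representative [w] inside the integrals. *)
Lemma Vp_coefficient (u w : R -> H) (psi : H) (l : R) :
  Vp E A T u -> {within `[0, T], continuous w} ->
  {ae leb, forall t, t \in `]0, T[ -> u t = w t} ->
  dom A psi -> A psi = l *: psi ->
  dot (w T) psi = expR (- (l ^+ 2 * T)) * dot (w 0) psi.
Proof.
move=> [[usob umeas _] uweak] cw uw dpsi Apsi.
pose c t := dot (w t) psi.
have cc : {within `[0, T], continuous c}.
  move=> t; apply: (cvg_comp w (fun x => dot x psi) (cw t)).
  exact: continuous_dotl.
have mul_cont (h : R -> R) : continuous h ->
    {within `[0, T], continuous (fun t => c t * h t)}.
  by move=> ch t; apply: cvgM; [exact: cc|exact: continuous_subspaceT].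
have swap (h : R -> R) : continuous h ->
    \int[leb]_(t in `]0, T[) (dot (u t) psi * h t) =
    \int[leb]_(t in `]0, T[) (c t * h t).
  move=> ch; apply: (congr1 fine); apply: ae_eq_integral => //.
  - apply/measurable_EFinP; apply: measurable_funM.
      exact: (measurable_dot E_le0 _ umeas).
    by apply: measurable_funTS; exact: continuous_measurable_fun.
  - exact: (measurable_int leb (continuous_integrable_oo (mul_cont _ ch))).
  - apply: (@filterS _ _ (ae_filter_ringOfSetsType leb) _ _ _ uw) => t ut t0T.
    by rewrite ut.
pose expl (t : R) : R := expR (l ^+ 2 * t).
have Aexpl : flat_algebra expl.
  apply: flat_algebra_exp; apply: flat_algebra_mul; first exact: flat_algebra_cst.
  exact: flat_algebra_id.
have dexpl (t : R) : is_derive t 1 expl (l ^+ 2 * expl t).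
  apply: (is_derive_eq (@is_derive1_comp _ expR (fun t => l ^+ 2 * t) t _ _
    (is_derive_expR _) (is_deriveZ (l ^+ 2) (is_derive_id t (1 : R))))).
  by rewrite [_ *: 1]mulr1 mulrC.
have : c T * expl T = c 0 * expl 0.
  apply: (@weak_constant _ (fun t => c t * expl t) T) => //.
    by apply: mul_cont; exact: flat_algebra_continuous.
  move=> eta a b Aeta a0 bT supp.
  pose theta t := expl t * eta t.
  have Atheta : flat_algebra theta by exact: flat_algebra_mul.
  have ttheta : test_function T theta.
    split=> [k t|]; first exact/flat_algebra_derivable/flat_algebra_derive1n.
    exists a, b; split=> // t; rewrite /theta mulf_eq0 negb_or => /andP[_]; exact: supp.
  have dtheta t : (theta^`())%classic t =
      l ^+ 2 * theta t + expl t * (eta^`())%classic t.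
    have deta : is_derive t 1 eta ((eta^`())%classic t).
      by rewrite derive1E; exact/derivableP/flat_algebra_derivable.
    rewrite derive1E; apply: (@derive_val _ _ _ t 1 theta).
    apply: (is_derive_eq (is_deriveM (dexpl t) deta)).
    by rewrite /theta /GRing.scale/=; ring.
  have ctheta : continuous (theta^`())%classic.
    exact/flat_algebra_continuous/flat_algebra_derive1.
  have cltheta : continuous (fun t => - (l ^+ 2) * theta t).
    apply/flat_algebra_continuous/flat_algebra_mul => //; exact: flat_algebra_cst.
  have spsi : sobolev E 1 psi by apply/(sobolev1_dom E_le0 _ E_A).
  have := uweak psi theta spsi ttheta; rewrite (swap _ ctheta).
  have -> : \int[leb]_(t in `]0, T[) (- square_op A (u t) psi * theta t) =
      \int[leb]_(t in `]0, T[) (dot (u t) psi * (- (l ^+ 2) * theta t)).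
    apply: eq_Rintegral => t; rewrite inE/= => t0T.
    have dut : dom A (u t) by apply/(sobolev1_dom E_le0 _ E_A)/usob.
    rewrite /square_op Apsi dotZr (spectral_functionC E_A)//.
    by rewrite Apsi dotZr; ring.
  rewrite (swap _ cltheta) => /eqP; rewrite -subr_eq0 opprK => /eqP.
  rewrite -RintegralD//; last 2 first.
  - exact/continuous_integrable_oo/mul_cont.
  - exact/continuous_integrable_oo/mul_cont.
  by move=> sum0; rewrite -[RHS]sum0; apply: eq_Rintegral => t _; rewrite dtheta /theta; ring.
rewrite /expl mulr0 expR0 mulr1 -/(c T) -/(c 0) => <-.
by rewrite expRN mulrC mulfK// gt_eqF// expR_gt0.
Qed.

End parabolic_coefficients.

Section iteration.
Variables (R : realType) (H : preHilbertType R).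

Lemma bounded_spectral_function_dom (E : spectral_family H) (g : measurableTypeR R -> R)
  (B : partial_op H) (C : R) v : measurable_fun setT g ->
  (forall l, g l ^+ 2 <= C) -> spectral_function E g B -> dom B v.
Proof.
move=> mg gC [-> _] /=.
apply: (@le_lt_trans _ _ (\int[spectral_measure E v]_l (cst C%:E) l)%E).
  apply: ge0_le_integral => //.
  - by move=> l _; rewrite lee_fin sqr_ge0.
  - by apply/measurable_EFinP; exact: measurable_funX.
  - by move=> l _; rewrite lee_fin.
by rewrite integral_cst// [X in (_ * X)%E](spectral_measureT E v) -EFinM ltry.
Qed.

(** At a spectral value [l] the contraction factor is [1 - gamma * g l] with
0 < gamma g(l) < 2, because l >= inf sigma(A) >= 0; the lower bound 0 comes from
positivity. *)
Lemma iteration_cvg (A : partial_op H)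
    (linear_A : linear_op A) (dense_A : dense (dom A))
    (positive_A : positive_op A)
    (discrete_A : discrete_spectrum A)
    (E : spectral_family H)
    (E_A : resolution_of_identity E A)
    (T : R) (T_gt0 : 0 < T)
    (expA : partial_op H)
    (expA_def : spectral_function E (fun l => expR (- (l ^+ 2 * T))) expA)
    (gamma : R) (gamma_gt0 : 0 < gamma)
    (gamma_lt : gamma < 2 * expR (inf (spectrum A) ^+ 2 * T))
    (f : H) (u : R -> H) (u_Vp : Vp E A T u)
    (u_T : trace_at T u T f) (phi : nat -> H)
    (phi_S : forall k, phi k.+1 = affine_op expA gamma f (phi k)) :
  exists2 u0, trace_at T u 0 u0 & phi k @[k --> \oo] --> u0.
Proof.
have [w [cw uw wT]] := u_T; exists (w 0); first by exists w.
pose g (l : R) := expR (- (l ^+ 2 * T)).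
have cg : continuous g.
  move=> l; apply: continuous_comp; last exact: continuous_expR.
  apply: cvgN; apply: cvgM; last exact: cvg_cst.
  by apply: cvgM; exact: cvg_id.
have mg : measurable_fun [set: measurableTypeR R] (g : measurableTypeR R -> R).
  exact: continuous_measurable_fun.
have g_ge0 l : 0 < g l by exact: expR_gt0.
have g_le1 l : g l ^+ 2 <= 1.
  rewrite exprn_ile1// ?(ltW (g_ge0 l))//.
  by rewrite /g -expR0 ler_expR oppr_le0 mulr_ge0 ?sqr_ge0// ltW.
have domB v : dom expA v by exact: (bounded_spectral_function_dom v mg g_le1 expA_def).
have dense_B : dense (dom expA).
  by move=> O [x Ox] _; exists x; split.
have test l v psi : jump_at E l psi -> dot (expA v) psi = g l * dot v psi.
  move=> jpsi; have [_ Bpsi] := jump_eigen mg (cg l) expA_def dense_B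
    (fun u v _ _ => conj (domB (u + v)) (domB (u - v))) jpsi.
  by rewrite (spectral_functionC expA_def)// Bpsi dotZr.
have E0 (m : R) v : m <= 0 -> E m v = 0.
  exact: (proj_le0 linear_A dense_A E_A _ positive_A discrete_A).
have eigen l psi : jump_at E l psi -> dom A psi /\ A psi = l *: psi.
  apply: (jump_eigen (@measurable_id _ _ setT) _ E_A dense_A).
    exact: cvg_id.
  exact: dom_addsub.
have fE : f = expA (w 0).
  apply/eqP; rewrite -subr_eq0; apply/eqP.
  apply: (jump_total linear_A dense_A E_A discrete_A) => l psi _ jpsi.
  have [dpsi Apsi] := eigen _ _ jpsi.
  rewrite dotBl (test l)// -wT.
  by rewrite (Vp_coefficient E_A T_gt0 E0 u_Vp cw uw dpsi Apsi) subrr.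
have e_cvg : phi k - w 0 @[k --> \oo] --> (0 : H).
  apply: (jump_contraction_cvg linear_A dense_A E_A discrete_A
    (r := fun l => 1 - gamma * g l)).
    move=> l sl.
    have lb0 : lbound (spectrum A) 0.
      by move=> m sm; apply/ltW; exact: (spectrum_gt0 positive_A discrete_A sm).
    have i0 : 0 <= inf (spectrum A) by apply: lb_le_inf => //; exists l.
    have il : inf (spectrum A) <= l by apply: ge_inf => //; exists 0.
    have gg : 0 < gamma * g l by rewrite mulr_gt0.
    suff : gamma * g l < 2 by rewrite ltr_norml; lra.
    rewrite /g expRN ltr_pdivrMr ?expR_gt0// (lt_le_trans gamma_lt)//.
    rewrite ler_pM2l// ler_expR ler_pM2r//.
    by rewrite lerXn2r ?nnegrE// (le_trans i0).
  move=> l psi k _ jpsi; rewrite phi_S /affine_op fE.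
  by rewrite !(dotBl, dotDl, dotZl) !(test l)//; ring.
by apply/subr_cvg0.
Qed.

End iteration.

Theorem theorem11 (R : realType) (n : nat) (Omega : set 'rV[R]_n)
    (open_Omega : open Omega) (bounded_Omega : bounded_set Omega)
    (smooth_Omega : smooth_boundary Omega)
    (A : partial_op (L2_domain open_Omega))
    (linear_A : linear_op A) (dense_A : dense (dom A))
    (self_adjoint_A : self_adjoint A) (positive_A : positive_op A)
    (discrete_A : discrete_spectrum A)
    (E : spectral_family (L2_domain open_Omega))
    (E_A : resolution_of_identity E A)
    (T : R) (T_gt0 : 0 < T)
    (expA : partial_op (L2_domain open_Omega))
    (expA_def : spectral_function E (fun l => expR (- (l ^+ 2 * T))) expA)
    (gamma : R) (gamma_gt0 : 0 < gamma)
    (gamma_lt : gamma < 2 * expR (inf (spectrum A) ^+ 2 * T))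
    (f : L2_domain open_Omega)
    (u : R -> L2_domain open_Omega) (u_Vp : Vp E A T u)
    (u_T : trace_at T u T f)
    (phi0 : L2_domain open_Omega) (phi : nat -> L2_domain open_Omega)
    (phi_0 : phi 0%N = phi0)
    (phi_S : forall k, phi k.+1 = affine_op expA gamma f (phi k)) :
  exists2 u0, trace_at T u 0 u0 & phi k @[k --> \oo] --> u0.
Proof.
exact: (iteration_cvg linear_A dense_A positive_A discrete_A E_A T_gt0 expA_def
  gamma_gt0 gamma_lt u_Vp u_T phi_S).
Qed.
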